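(* Let $G=G(n)$ be a sequence of simple graphs with vertex set $\{1,\ldots,n\}$, degrees $d_1,\ldots,d_n$ and maximum degree $\varDelta=\varDelta(n)$, and let $\boldsymbol b=\boldsymbol b(n)$ be the imbalance sequence of some orientation of $G$. Assume that the following hold as $n\to\infty$. (A1) $n^{1/3+\varepsilon}\le \varDelta\le n-1$ for some constant $\varepsilon>0$. (A2) $h(G)\ge\gamma\varDelta$ for some constant $\gamma>0$. (A3) The equations $\sum_{k:jk\in G}\frac{r_j-r_k}{r_j+r_k}=b_j$ ($1\le j\le n$) have a solution $\boldsymbol r=(r_1,\ldots,r_n)$ with positive entries such that $\frac{r_j}{r_k}\le 1+R$ for all $jk\in G$, where $R=R(n)$ satisfies $0\le R=O(1)$ and $R^2\,\frac{n}{\varDelta}\log\frac{2n}{\varDelta}=o(\log n)$. Then, with $f_3,f_4,f_6$ and $\boldsymbol X$ as defined in the context, $$\mathbb E f_4(\boldsymbol X)=-\tfrac14\sum_{jk\in G}\bigl(d_j^{-1}+d_k^{-1}\bigr)^2+O\Bigl(R^2\varDelta^{-1}n+\varDelta^{-2}n\log\tfrac{2n}{\varDelta}\Bigr)=O(\varDelta^{-1}n),$$ $$\operatorname{Var}f_3(\boldsymbol X)=O\Bigl(R^2\varDelta^{-1}n\log\tfrac{2n}{\varDelta}\Bigr),$$ and both $\mathbb E f_6(\boldsymbol X)$ and $\operatorname{Var}f_4(\boldsymbol X)$ are $O\bigl(\varDelta^{-2}n\log\frac{2n}{\varDelta}\bigr)$.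
   Context: An orientation of $G$ assigns one of the two directions to each edge. The imbalance of a vertex is its out-degree minus its in-degree; the imbalance sequence lists these for all vertices. The Cheeger constant is $h(G)=\min\{|\partial_G U|/|U| : U\subset V(G),\ 1\le |U|\le \frac12|V(G)|\}$, where $\partial_G U$ is the set of edges with exactly one end in $U$. For $jk\in G$ (meaning $jk$ is an edge of $G$), let $\lambda_{jk}=\frac{r_j}{r_j+r_k}$. Let $J$ be the $n\times n$ all-ones matrix and let $L$ be the symmetric positive-semidefinite matrix with $\boldsymbol x^{\mathrm T}L\boldsymbol x=2\sum_{jk\in G}\lambda_{jk}\lambda_{kj}(x_j-x_k)^2$ for $\boldsymbol x\in\mathbb R^n$ (sums over $jk\in G$ are over unordered edges, each counted once). Define $A=\frac{\varDelta}{n}J+L$ and $$f_3(\boldsymbol x)=-\tfrac43\sum_{jk\in G}\lambda_{jk}\lambda_{kj}(\lambda_{jk}-\lambda_{kj})(x_j-x_k)^3,$$ $$f_4(\boldsymbol x)=\tfrac23\sum_{jk\in G}\lambda_{jk}\lambda_{kj}(1-6\lambda_{jk}\lambda_{kj})(x_j-x_k)^4,$$ $$f_6(\boldsymbol x)=-\tfrac4{45}\sum_{jk\in G}\lambda_{jk}\lambda_{kj}(1-30\lambda_{jk}\lambda_{kj}+120\lambda_{jk}^2\lambda_{kj}^2)(x_j-x_k)^6.$$ $\boldsymbol X$ is an $n$-dimensional normal random vector with density $\pi^{-n/2}|A|^{1/2}e^{-\boldsymbol x^{\mathrm T}A\boldsymbol x}$, where $|A|$ is the determinant of $A$. Statements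 are for $n$ sufficiently large and $\varepsilon$ sufficiently small; implicit constants may depend on $\varepsilon$, $\gamma$ and the bounds implicit in (A3). *)

(* Defs.v *)
From HB Require Import structures.
From mathcomp Require Import all_boot all_order all_algebra.
From mathcomp Require Import all_classical all_reals all_analysis.
From mathcomp Require Import ring.

Set Implicit Arguments.
Unset Strict Implicit.
Unset Printing Implicit Defensive.

Import Order.TTheory GRing.Theory Num.Theory.
Import numFieldNormedType.Exports.

Local Open Scope classical_set_scope.
Local Open Scope ring_scope.

Definition simple_graph n (e : rel 'I_n) := symmetric e /\ irreflexive e.

(* An unordered edge {j, k} is represented by the pair (j, k) with j < k. *)
Definition edges n (e : rel 'I_n) : {set 'I_n * 'I_n} :=
  [set p : 'I_n * 'I_n | (p.1 < p.2)%N && e p.1 p.2].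

Definition deg n (e : rel 'I_n) (j : 'I_n) : nat := #|[pred k | e j k]|.

Definition maxdeg n (e : rel 'I_n) : nat := \max_(j < n) deg e j.

(* o j k means that edge jk is directed from j to k. *)
Definition orientation n (e o : rel 'I_n) :=
  (forall j k, o j k -> e j k) /\ (forall j k, e j k -> o j k = ~~ o k j).

Definition imbalance n (o : rel 'I_n) (j : 'I_n) : int :=
  #|[pred k | o j k]|%:Z - #|[pred k | o k j]|%:Z.

Definition boundary n (e : rel 'I_n) (U : {set 'I_n}) : {set 'I_n * 'I_n} :=
  [set p in edges e | (p.1 \in U) (+) (p.2 \in U)].

(* The set is finite, and nonempty as soon as n >= 2, so that the infimum is
   a minimum. *)
Definition cheeger (R : realType) n (e : rel 'I_n) : R :=
  inf [set x : R | exists U : {set 'I_n},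
    [/\ (1 <= #|U|)%N, #|U|%:R <= n%:R / 2 :> R
      & x = #|boundary e U|%:R / #|U|%:R]].

Section Forms.
Context {R : realType} {n : nat}.
Implicit Types (e : rel 'I_n) (r : 'I_n -> R) (x : 'rV[R]_n).

Definition lam r (j k : 'I_n) : R := r j / (r j + r k).

Definition Lmx e r : 'M[R]_n :=
  \matrix_(j, k)
    if j == k then 2 * \sum_(l | e j l) lam r j l * lam r l j
    else if e j k then - 2 * (lam r j k * lam r k j) else 0.

(* x L x^T = Lquad e r x for row vectors x; by LmxP below, Lmx is the unique
   symmetric matrix of this quadratic form. *)
Definition Lquad e r x : R :=
  2 * \sum_(p in edges e)
        lam r p.1 p.2 * lam r p.2 p.1 * (x 0 p.1 - x 0 p.2) ^+ 2.

Definition Amx e r : 'M[R]_n :=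
  ((maxdeg e)%:R / n%:R) *: const_mx 1 + Lmx e r.

Lemma sum_edges e (F : 'I_n -> 'I_n -> R) : simple_graph e ->
  (forall j k, F j k = F k j) ->
  \sum_j \sum_(k | e j k) F j k = 2 * \sum_(p in edges e) F p.1 p.2.
Proof.
move=> [es ei] FC; rewrite pair_big_dep/=.
rewrite (bigID (fun p : 'I_n * 'I_n => (p.1 < p.2)%N))/=.
rewrite mulr_natl mulr2n; congr (_ + _).
  by apply: eq_bigl => -[j k]; rewrite inE/= andbC.
pose sw (p : 'I_n * 'I_n) := (p.2, p.1).
have swK : involutive sw by case.
rewrite (reindex_inj (inv_inj swK))/=.
apply: eq_big => [[j k]|[j k] _]; last exact: FC.
rewrite inE/= es -leqNgt leq_eqVlt andbC.
by case: eqP => [/val_inj->|//]; rewrite ei ltnn.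
Qed.

Lemma LmxP e r : simple_graph e ->
  [/\ (Lmx e r)^T = Lmx e r,
      forall x, (x *m Lmx e r *m x^T) 0 0 = Lquad e r x
    & forall M : 'M[R]_n, M^T = M ->
        (forall x, (x *m M *m x^T) 0 0 = Lquad e r x) -> M = Lmx e r].
Proof.
move=> se; have [es ei] := se.
have Lsym : (Lmx e r)^T = Lmx e r.
  apply/matrixP => j k; rewrite !mxE eq_sym; case: eqVneq => [->//|_].
  by rewrite es [lam r k j * _]mulrC.
have Lq x : (x *m Lmx e r *m x^T) 0 0 = Lquad e r x.
  pose c j k := lam r j k * lam r k j.
  have cC j k : c j k = c k j by rewrite /c mulrC.
  rewrite /Lquad -(sum_edges (F := fun j k => c j k * (x 0 j - x 0 k) ^+ 2))//;
    last by move=> j k; rewrite cC -sqrrN opprB.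
  transitivity (\sum_j \sum_(k | e j k)
      (2 * (c j k * x 0 j ^+ 2) - 2 * (c j k * x 0 j * x 0 k))).
    rewrite !mxE; apply: eq_bigr => j _; rewrite !mxE sumrB.
    rewrite (bigD1 j)//= !mxE eqxx mulrDl; congr (_ + _).
      rewrite mulrA [x 0 j * 2]mulrC !mulr_sumr !mulr_suml.
      by apply: eq_bigr => k _; rewrite /c; ring.
    rewrite mulr_suml -sumrN big_mkcond [RHS]big_mkcond/=.
    apply: eq_bigr => k _; rewrite !mxE; case: eqVneq => [->|_]/=.
      by rewrite ei.
    by rewrite es; case: ifP => _; rewrite /c; ring.
  have sw : \sum_j \sum_(k | e j k) c j k * x 0 j ^+ 2 =
            \sum_j \sum_(k | e j k) c j k * x 0 k ^+ 2.
    rewrite (exchange_big_dep predT)//=; apply: eq_bigr => j _.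
    by apply: eq_big => [k|k _]; [rewrite es|rewrite cC].
  transitivity (\sum_j \sum_(k | e j k) c j k * x 0 j ^+ 2
    + \sum_j \sum_(k | e j k) c j k * x 0 j ^+ 2
    - \sum_j \sum_(k | e j k) 2 * (c j k * x 0 j * x 0 k)).
    rewrite -big_split -sumrB; apply: eq_bigr => j _.
    by rewrite -big_split -sumrB; apply: eq_bigr => k _ /=; ring.
  rewrite {2}sw -big_split -sumrB; apply: eq_bigr => j _.
  by rewrite -big_split -sumrB; apply: eq_bigr => k _ /=; ring.
split=> // M Msym Mq; pose D := M - Lmx e r.
have Dsym j k : D k j = D j k.
  have DT : D^T = D by rewrite linearB/= Msym Lsym.
  by rewrite -[in LHS]DT mxE.
have Dq x : (x *m D *m x^T) 0 0 = 0.
  by rewrite mulmxBr mulmxBl [LHS]mxE [X in _ + X]mxE Mq Lq subrr.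
have Dd j k : ((delta_mx 0 j : 'rV_n) *m D *m (delta_mx 0 k : 'rV_n)^T) 0 0
    = D j k.
  by rewrite trmx_delta -rowE -colE !mxE.
suff D0 : D = 0 by apply/eqP; rewrite -subr_eq0 -/D D0.
apply/matrixP => j k; rewrite [RHS]mxE.
have := Dq (delta_mx 0 j + delta_mx 0 k).
have Djj i : D i i = 0 by rewrite -Dd Dq.
have addE (A B : 'M[R]_1) : (A + B) 0 0 = A 0 0 + B 0 0 by rewrite mxE.
rewrite [(_ + _)^T]linearD/= mulmxDr !mulmxDl !addE.
rewrite !Dd !Djj Dsym add0r addr0 => /eqP.
by rewrite -mulr2n mulrn_eq0/= => /eqP.
Qed.

Definition f3 e r x : R :=
  - (4 / 3) * \sum_(p in edges e)
    lam r p.1 p.2 * lam r p.2 p.1 * (lam r p.1 p.2 - lam r p.2 p.1)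
    * (x 0 p.1 - x 0 p.2) ^+ 3.

Definition f4 e r x : R :=
  2 / 3 * \sum_(p in edges e)
    lam r p.1 p.2 * lam r p.2 p.1 * (1 - 6 * (lam r p.1 p.2 * lam r p.2 p.1))
    * (x 0 p.1 - x 0 p.2) ^+ 4.

Definition f6 e r x : R :=
  - (4 / 45) * \sum_(p in edges e)
    lam r p.1 p.2 * lam r p.2 p.1
    * (1 - 30 * (lam r p.1 p.2 * lam r p.2 p.1)
         + 120 * (lam r p.1 p.2 ^+ 2 * lam r p.2 p.1 ^+ 2))
    * (x 0 p.1 - x 0 p.2) ^+ 6.

Definition gauss_density (A : 'M[R]_n) x : R :=
  pi `^ (- (n%:R / 2)) * Num.sqrt (\det A) * expR (- (x *m A *m x^T) 0 0).

End Forms.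

Section LebesgueTuple.
Context (R : realType).
Local Open Scope ereal_scope.
Local Notation RT := (measurableTypeR R).

Section Step.
Context (n : nat) (m : {sigma_finite_measure set (n.-tuple RT) -> \bar R}).

Let consp (p : RT * n.-tuple RT) : n.+1.-tuple RT := [tuple of p.1 :: p.2].
Let unconsp (t : n.+1.-tuple RT) : RT * n.-tuple RT :=
  (thead t, [tuple of behead t]).

Definition leb_cons : set (n.+1.-tuple RT) -> \bar R :=
  pushforward (@lebesgue_measure R \x m) consp.

Let mconsp : measurable_fun [set: RT * n.-tuple RT] consp.
Proof. exact: measurable_cons. Qed.

Let munconsp : measurable_fun [set: n.+1.-tuple RT] unconsp.
Proof.
apply/measurable_fun_pair.
  exact: measurable_tnth.
exact: measurable_behead.
Qed.

Let leb_cons0 : leb_cons set0 = 0.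
Proof. by rewrite /leb_cons /pushforward preimage_set0 measure0. Qed.

Let leb_cons_ge0 A : 0 <= leb_cons A.
Proof. exact: measure_ge0. Qed.

Let leb_cons_sigma_additive : semi_sigma_additive leb_cons.
Proof.
move=> F mF tF mUF; rewrite /leb_cons /pushforward preimage_bigcup.
apply: measure_semi_sigma_additive.
- by move=> k; rewrite -[X in measurable X]setTI; exact: mconsp.
- apply/trivIsetP => /= i j _ _ ij; rewrite -preimage_setI.
  by move/trivIsetP : tF => /(_ _ _ _ _ ij) ->//; rewrite preimage_set0.
- by rewrite -preimage_bigcup -[X in measurable X]setTI; exact: mconsp.
Qed.

HB.instance Definition _ := isMeasure.Build _ _ _ leb_cons
  leb_cons0 leb_cons_ge0 leb_cons_sigma_additive.

Let leb_cons_sigma_finite : sigma_finite setT leb_cons.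
Proof.
have /sigma_finiteP[F [TF ndF Foo]] := sigma_finiteT (@lebesgue_measure R).
have /sigma_finiteP[G [TG ndG Goo]] := sigma_finiteT m.
exists (fun i => unconsp @^-1` (F i `*` G i)).
  rewrite -preimage_bigcup (_ : \bigcup_i _ = setT) ?preimage_setT//.
  apply/seteqP; split=> // -[x y] _.
  have [[i _ Fix] [j _ Gjy]] : (\bigcup_i F i) x /\ (\bigcup_i G i) y.
    by rewrite -TF -TG.
  exists (maxn i j) => //; split.
  - by move: x Fix; exact/subsetPset/ndF/leq_maxl.
  - by move: y Gjy; exact/subsetPset/ndG/leq_maxr.
move=> i; have [mF Foo'] := Foo i; have [mG Goo'] := Goo i; split.
  by rewrite -[X in measurable X]setTI; apply: munconsp => //; exact: measurableX.
rewrite /leb_cons /pushforward -comp_preimage.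
rewrite (_ : unconsp \o consp = id) ?preimage_id.
  by rewrite product_measure1E// lte_mul_pinfty// ge0_fin_numE.
apply/funext => -[a t] /=; rewrite /unconsp/=; congr pair.
exact: val_inj.
Qed.

HB.instance Definition _ := Measure_isSigmaFinite.Build _ _ _ leb_cons
  leb_cons_sigma_finite.

End Step.

(* The n-dimensional Lebesgue measure (see leb_box), as an iterated product of
   one-dimensional ones; the 0-dimensional space is a point of mass 1. *)
Fixpoint leb n : {sigma_finite_measure set (n.-tuple RT) -> \bar R} :=
  if n is k.+1 then leb_cons (leb k) else \d_([tuple] : 0.-tuple RT).

End LebesgueTuple.

Section LebesgueTupleBox.
Context (R : realType).
Local Open Scope ereal_scope.

Lemma leb_box n (A : 'I_n -> set (measurableTypeR R)) :
  (forall i, measurable (A i)) ->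
  leb R n [set t | forall i, A i (tnth t i)] =
  \prod_(i < n) lebesgue_measure (A i).
Proof.
elim: n A => [A _|n IH A mA].
  rewrite big_ord0 /= diracE mem_set//=.
  by case.
rewrite big_ord_recl -IH//= /leb_cons /pushforward.
rewrite (_ : _ @^-1` _ =
    A ord0 `*` [set t | forall i, A (lift ord0 i) (tnth t i)]).
  rewrite product_measure1E//.
  rewrite (_ : [set t | _] =
    \bigcap_(i in [set: 'I_n]) ((@tnth n _ ^~ i) @^-1` A (lift ord0 i))).
    apply: fin_bigcap_measurable => // i _.
    by rewrite -[X in measurable X]setTI; exact: measurable_tnth.
  by apply/seteqP; split => t /= h i; [move=> _; exact: h|exact: (h i I)].
apply/seteqP; split => -[a t] /= => [h|[h0 h] i].
  split; first exact: (h ord0).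
  by move=> i; have := h (lift ord0 i); rewrite tnthS.
by case: (unliftP ord0 i) => [j|] ->//; rewrite tnthS.
Qed.

End LebesgueTupleBox.

Definition row_of_tuple (R : Type) n (t : n.-tuple R) : 'rV[R]_n :=
  \row_j tnth t j.

(* The random vector X has density p with respect to the n-dimensional
   Lebesgue measure. *)
Definition has_density d (T : measurableType d) (R : realType)
    (P : probability T R) n (X : {RV P >-> n.-tuple (measurableTypeR R)})
    (p : 'rV[R]_n -> R) :=
  forall B, measurable B ->
    distribution P X B = (\int[leb R n]_(t in B) (p (row_of_tuple t))%:E)%E.

(* Main.v *)
(* Write [S = (2 A)^-1] for the covariance matrix of [X] and [c p q] for the
   covariance of the increments of [X] along the edges [p] and [q].

   Moments: completing the square in the density turns the moment generating
   function of a linear form into a translate of the total mass, so that only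
   translation invariance of Lebesgue measure is needed.  Expanding
   [cosh (s Y)] gives the even moments of one linear form, and polarisation the
   mixed moments [E Y^3 Z^3] and [E Y^4 Z^4].

   Covariances: by the Cheeger inequality and (A3), [2 A] is bounded below by a
   constant times [Delta].  Hence [c p q = O(1 / Delta)].  Moreover the
   Laplacian of [G] is at most a constant times [2 A], so that [sum_q (c p q)^2]
   is at most a constant times [c p p], and the matrix [c] has bounded norm as an
   operator on functions of edges.  Summing over the [O(n Delta)] edges gives
   all the estimates, even without the logarithms. *)
Require Import Defs.
From HB Require Import structures.
From mathcomp Require Import all_boot all_order all_algebra.
From mathcomp Require Import all_classical all_reals all_analysis.
From mathcomp Require Import measurable_realfun ring lra.

Set Implicit Arguments.
Unset Strict Implicit.
Unset Printing Implicit Defensive.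

Import Order.TTheory GRing.Theory Num.Theory.
Import numFieldNormedType.Exports.

Local Open Scope ring_scope.

(** * Poincare inequality from the Cheeger constant *)

(** The obstacle is in the two variances. There can be of order (n Delta)^2 pairs of edges, and the
    pointwise bound [c p q = O(1 / Delta)] only gives O(n^2) for the sum of all [(c p q)^2], where
    O(n) is wanted. In the second moment of f3 there is moreover a term that is linear in [c p q];
    not even the O(n) bound with Cauchy-Schwarz controls it, and this is where the operator norm of
    [c] is needed.

    The main term of E f4 arises as follows. On an edge with r_j = r_k the coefficient in f4 is
    -1/12, the fourth moment of the increment is [3 * (c p p)^2], and [c p p] is close to 1/d_j +
    1/d_k. For general r, the product 4 lam_jk lam_kj differs from 1 by exactly (lam_jk - lam_kj)^2,
    which is why R enters the error squared.

    Since Delta <= n, the factor log(2n/Delta) is at least log 2, so estimates without it imply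
    those stated. *)

Section Poincare.
Context {R : realType} {n : nat}.
Variable e : rel 'I_n.
Hypothesis se : simple_graph e.
Implicit Types (x y f : 'I_n -> R) (U : {set 'I_n}).

Definition energy f : R := \sum_(p in edges e) (f p.1 - f p.2) ^+ 2.

Lemma mem_boundary U p : (p \in boundary e U) =
  (p \in edges e) && ((p.1 \in U) (+) (p.2 \in U)).
Proof. by rewrite /boundary finset.in_set. Qed.

(** The median is taken as the least entry that at most half of the entries exceed. The largest
    entry below it is then exceeded by more than half of them, which leaves at most half below the
    median. *)
Lemma median_exists x : (0 < n)%N -> exists m,
  (#|[set i | (m < x i)%R]|.*2 <= n)%N /\ (#|[set i | (x i < m)%R]|.*2 <= n)%N.
Proof.
move=> n0; pose i0 : 'I_n := Ordinal n0.
pose Q i := (#|[set j | (x i < x j)%R]|.*2 <= n)%N.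
case: (@arg_maxP _ _ _ i0 xpredT x isT) => im _ im_max';
  have im_max j : x j <= x im := im_max' j isT.
have Qim : Q im.
  rewrite /Q (_ : [set j | _] = finset.set0) ?cards0//.
  by apply/setP => j; rewrite !inE ltNge im_max.
case: (@arg_minP _ _ _ im Q x Qim) => i Qi i_min'.
have i_min j : Q j -> x i <= x j := i_min' j.
exists (x i); split => //.
have [->|/set0Pn[j0]] := eqVneq [set j | (x j < x i)%R] finset.set0.
  by rewrite cards0.
rewrite inE => j0i.
case: (@arg_maxP _ _ _ j0 (fun j => x j < x i) x j0i) => k ki k_max'.
have k_max j : x j < x i -> x j <= x k := k_max' j.
have nQk : ~~ Q k by apply/negP => /i_min; rewrite leNgt ki.
have sub : [set j | (x j < x i)%R] \subset ~: [set j | (x k < x j)%R].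
  by apply/fintype.subsetP => j; rewrite !inE -leNgt => /k_max.
move/subset_leq_card : sub; rewrite -ltnNge in nQk.
have := cardsC [set j | (x k < x j)%R]; rewrite card_ord => nE.
rewrite -leq_double => /leq_trans; apply.
by rewrite -(leq_add2l #|[set j | (x k < x j)%R]|.*2) -doubleD nE -addnn
  leq_add2r ltnW.
Qed.

Section LayerCake.
Variable h : R.
Hypothesis hU : forall U, (1 <= #|U|)%N -> (#|U|.*2 <= n)%N ->
  h * #|U|%:R <= #|boundary e U|%:R.

(** Discrete coarea inequality, by induction on the size of the support [U]. Subtracting the least
    positive value [m] on [U] lowers the sum of [f] by [m * #|U|] and the total variation by exactly
    [m * #|boundary e U|]. *)
Lemma layer_cake f : (forall i, 0 <= f i) ->
  (#|[set i | (0 < f i)%R]|.*2 <= n)%N ->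
  h * \sum_i f i <= \sum_(p in edges e) `|f p.1 - f p.2|.
Proof.
move: {2}#|_| (leqnn #|[set i | (0 < f i)%R]|) => k.
elim: k f => [|k IH] f.
  rewrite leqn0 cards_eq0 => /eqP f00 f0 _.
  have fE i : f i = 0.
    apply/eqP; rewrite eq_le f0 andbT leNgt; apply/negP => fi.
    by have /setP/(_ i) := f00; rewrite !inE fi.
  rewrite big1 => [|i _]; last exact: fE.
  by rewrite mulr0 sumr_ge0.
set U := [set i | (0 < f i)%R] => Uk f0 Un.
have [U0|/set0Pn[i0]] := eqVneq U finset.set0.
  by apply: IH => //; rewrite -/U U0 cards0.
rewrite inE => fi0.
case: (@arg_minP _ _ _ i0 (fun i => 0 < f i) f fi0) => i fi i_min'.
have i_min j : 0 < f j -> f i <= f j := i_min' j.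
pose m := f i; pose g j := if 0 < f j then f j - m else 0.
have fU j : j \in U = (0 < f j) by rewrite inE.
have fN j : ~~ (0 < f j) -> f j = 0.
  by rewrite -leNgt => fj; apply/eqP; rewrite eq_le fj f0.
have g0 j : 0 <= g j by rewrite /g; case: ifP => // fj; rewrite subr_ge0 i_min.
have sub : [set j | (0 < g j)%R] \subset U :\ i.
  apply/fintype.subsetP => j; rewrite !inE /g; case: ifPn; last by rewrite ltxx.
  by rewrite subr_gt0 andbT; case: eqVneq => // ->; rewrite ltxx.
have gk : (#|[set j | (0 < g j)%R]| <= k)%N.
  rewrite (leq_trans (subset_leq_card sub))//.
  by rewrite -ltnS (leq_trans _ Uk)// [leqRHS](cardsD1 i) fU fi.
have gn : (#|[set j | (0 < g j)%R]|.*2 <= n)%N.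
  rewrite (leq_trans _ Un)// leq_double (leq_trans (subset_leq_card sub))//.
  by rewrite subset_leq_card// subD1set.
have {IH} := IH g gk g0 gn.
have U1 : (1 <= #|U|)%N by rewrite card_gt0; apply/set0Pn; exists i; rewrite fU.
have := hU U1 Un.
have -> : \sum_j f j = \sum_j g j + m * #|U|%:R.
  rewrite -sumr_const mulr_sumr [X in _ = _ + X]big_mkcond -big_split/=.
  apply: eq_bigr => j _; rewrite fU /g; case: ifPn => [_|/fN ->];
    last by rewrite addr0.
  by rewrite mulr1 subrK.
have -> : \sum_(p in edges e) `|f p.1 - f p.2| =
    \sum_(p in edges e) `|g p.1 - g p.2| + m * #|boundary e U|%:R.
  rewrite -sumr_const mulr_sumr /boundary.
  rewrite [X in _ = _ + X]big_mkcond/= [LHS]big_mkcond/=.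
  rewrite [X in _ = X + _]big_mkcond/= -big_split/=.
  apply: eq_bigr => -[a b] _; rewrite mem_boundary /=.
  case: ((a, b) \in edges e); last by rewrite /= addr0.
  rewrite /= !fU /g; case: ifPn => fa; case: ifPn => fb /=.
  - by rewrite addr0; congr `|_|; ring.
  - by rewrite (fN b fb) !subr0 !ger0_norm ?subr_ge0 ?i_min// mulr1 subrK.
  - rewrite (fN a fa) !sub0r !normrN !ger0_norm ?subr_ge0 ?i_min//.
    by rewrite mulr1 subrK.
  - by rewrite (fN a fa) (fN b fb) addr0.
move=> hB IH; have := ler_wpM2l (f0 i) hB; rewrite -/m => hB'.
by rewrite mulrDr lerD// mulrCA.
Qed.
End LayerCake.

Lemma sum_edges_endpoints f :
  \sum_(p in edges e) (f p.1 + f p.2) = \sum_i (deg e i)%:R * f i.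
Proof.
apply: (@mulfI _ 2) => //.
rewrite -(sum_edges (F := fun j k => f j + f k))//; last by move=> j k;
  rewrite addrC.
have E : \sum_j \sum_(k | e j k) f j = \sum_i (deg e i)%:R * f i.
  apply: eq_bigr => j _; rewrite sumr_const -[LHS]mulr_natl; congr (_%:R * _).
rewrite -E; under eq_bigr do rewrite big_split.
rewrite big_split/= mulr_natl mulr2n; congr (_ + _).
rewrite (exchange_big_dep predT)//=; apply: eq_bigr => j _.
by apply: eq_bigl => k; have [es _] := se; rewrite es.
Qed.

Lemma deg_le_maxdeg i : (deg e i <= maxdeg e)%N.
Proof. exact: (leq_bigmax (F := fun j => deg e j)). Qed.

Variable gamma : R.
Hypothesis gamma0 : 0 < gamma.
Local Notation Delta := (maxdeg e)%:R.
Hypothesis hU : forall U, (1 <= #|U|)%N -> (#|U|.*2 <= n)%N ->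
  gamma * Delta * #|U|%:R <= #|boundary e U|%:R.

(** The argument of Cheeger's inequality: [layer_cake] is applied to the square of [f]. A weighted
    AM-GM inequality replaces Cauchy-Schwarz, with weights such that the degree term absorbs just
    half of the left-hand side. *)
Lemma energy_half f : (forall i, 0 <= f i) ->
  (#|[set i | (0 < f i)%R]|.*2 <= n)%N ->
  gamma ^+ 2 * Delta / 2 * \sum_i f i ^+ 2 <= energy f.
Proof.
move=> f0 fn.
have := @layer_cake _ hU (fun i => f i ^+ 2) _ _.
have -> : [set i | (0 < f i ^+ 2)%R] = [set i | (0 < f i)%R].
  by apply/setP => i; rewrite !inE exprn_even_gt0//= lt_def f0 andbT.
move=> /(_ (fun i => sqr_ge0 _) fn) lc.
have amgm : \sum_(p in edges e) `|f p.1 ^+ 2 - f p.2 ^+ 2| <=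
    gamma^-1 * energy f +
    gamma / 2 * \sum_(p in edges e) (f p.1 ^+ 2 + f p.2 ^+ 2).
  rewrite !mulr_sumr -big_split/=; apply: ler_sum => p _.
  have E : (f p.1 - f p.2) ^+ 2 * gamma^-1 =
      gamma * ((f p.1 - f p.2) / gamma) ^+ 2.
    by field; rewrite gt_eqF.
  rewrite [gamma^-1 * _]mulrC E.
  set t := (f p.1 - f p.2) / gamma.
  have tE : f p.1 - f p.2 = gamma * t by rewrite /t mulrCA divff ?mulr1// gt_eqF.
  rewrite subr_sqr normrM (ger0_norm (addr_ge0 (f0 _) (f0 _))) tE normrM
    (gtr0_norm gamma0).
  rewrite -(real_normK (num_real t)) -!mulrA -mulrDr ler_pM2l//.
  have := sqr_ge0 (`|t| - (f p.1 + f p.2) / 2).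
  have := sqr_ge0 (f p.1 - f p.2); nra.
rewrite (sum_edges_endpoints (fun i => f i ^+ 2)) in amgm.
have degs : \sum_i (deg e i)%:R * f i ^+ 2 <= Delta * \sum_i f i ^+ 2.
  rewrite mulr_sumr; apply: ler_sum => i _; apply: ler_wpM2r; first exact: sqr_ge0.
  by rewrite ler_nat deg_le_maxdeg.
have := le_trans lc (le_trans amgm (lerD (lexx _) (ler_wpM2l _ degs))).
rewrite divr_ge0 ?(ltW gamma0)// => /(_ isT) K.
have {}K : gamma * Delta / 2 * \sum_i f i ^+ 2 <= gamma^-1 * energy f by lra.
have := ler_wpM2l (ltW gamma0) K; rewrite [leRHS]mulrA divff ?mul1r ?gt_eqF//.
by apply: le_trans; rewrite le_eqVlt; apply/orP; left; apply/eqP; ring.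
Qed.

(** Subtracting a median makes the positive part [y] and the negative part [z] each live on at most
    half of the vertices, as [energy_half] requires. Replacing the median by the mean afterwards
    only decreases the sum of squares. *)
Lemma poincare x : (0 < n)%N ->
  gamma ^+ 2 * Delta / 2 * (\sum_i x i ^+ 2 - (\sum_i x i) ^+ 2 / n%:R) <= energy x.
Proof.
move=> n0; have [m [m1 m2]] := median_exists x n0.
pose y i := Num.max (x i - m) 0; pose z i := Num.max (m - x i) 0.
have y0 i : 0 <= y i by rewrite le_max lexx orbT.
have z0 i : 0 <= z i by rewrite le_max lexx orbT.
have yn : (#|[set i | (0 < y i)%R]|.*2 <= n)%N.
  rewrite (_ : [set i | _] = [set i | (m < x i)%R])//.
  by apply/setP => i; rewrite !inE lt_max ltxx orbF subr_gt0.
have zn : (#|[set i | (0 < z i)%R]|.*2 <= n)%N.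
  rewrite (_ : [set i | _] = [set i | (x i < m)%R])//.
  by apply/setP => i; rewrite !inE lt_max ltxx orbF subr_gt0.
have Ey := energy_half y0 yn; have Ez := energy_half z0 zn.
(* Along an edge, the differences of [y] and of [z] never have the same strict sign, so the cross
   term in the square of their difference is nonnegative. *)
have Ex : energy y + energy z <= energy x.
  rewrite -big_split/=; apply: ler_sum => p _; rewrite /y /z.
  by case: (lerP (x p.1 - m) 0); case: (lerP (x p.2 - m) 0);
    case: (lerP (m - x p.1) 0); case: (lerP (m - x p.2) 0) => *; nra.
apply: le_trans Ex; apply: le_trans (lerD Ey Ez).
rewrite -mulrDr; apply: ler_wpM2l.
  by rewrite divr_ge0// mulr_ge0// exprn_ge0// ltW.
rewrite -big_split/=.
have -> : \sum_i (y i ^+ 2 + z i ^+ 2) =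
    \sum_i x i ^+ 2 - 2 * m * \sum_i x i + n%:R * m ^+ 2.
  have -> : n%:R * m ^+ 2 = \sum_(i < n) m ^+ 2
    by rewrite sumr_const card_ord mulr_natl.
  rewrite mulr_sumr -sumrB -big_split/=; apply: eq_bigr => i _; rewrite /y /z.
  by case: (lerP (x i - m) 0); case: (lerP (m - x i) 0) => *; nra.
have n0' : 0 < n%:R :> R by rewrite ltr0n.
set s := \sum_i x i; set q := \sum_i x i ^+ 2.
have : 0 <= n%:R * (m - s / n%:R) ^+ 2 by rewrite mulr_ge0 ?sqr_ge0// ltW.
have -> : n%:R * (m - s / n%:R) ^+ 2 =
    n%:R * m ^+ 2 - 2 * m * s + s ^+ 2 / n%:R.
  by field; rewrite gt_eqF.
lra.
Qed.

Lemma card_boundary1 i : (#|boundary e [set i]| <= deg e i)%N.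
Proof.
rewrite -(ler_nat R).
have -> : #|boundary e [set i]|%:R = \sum_(p in edges e)
    (((p.1 \in [set i]) (+) (p.2 \in [set i]))%:R : R).
  rewrite -sum1_card natr_sum /boundary big_mkcond [RHS]big_mkcond/=.
  apply: eq_bigr => p _; rewrite mem_boundary; case: (p \in edges e) => //=.
  by case: ((p.1 \in _) (+) _).
apply: (@le_trans _ _ (\sum_(p in edges e)
    ((p.1 \in [set i])%:R + (p.2 \in [set i])%:R))).
  apply: ler_sum => p _.
  by case: (p.1 \in _); case: (p.2 \in _) => /=; rewrite ?addr0 ?add0r// addr_ge0.
rewrite (sum_edges_endpoints (fun j => (j \in [set i])%:R)).
rewrite (bigD1 i)//= inE eqxx mulr1.
rewrite big1 ?addr0// => j ji; by rewrite inE (negbTE ji) mulr0.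
Qed.

(** The isoperimetric hypothesis at a singleton, which is at most half of the vertices because
    [1 < n]. Hence all degrees are of order [Delta]. *)
Lemma deg_lower i : (1 < n)%N -> gamma * Delta <= (deg e i)%:R.
Proof.
move=> n1; have := hU (U := [set i]); rewrite cards1 => /(_ isT n1).
rewrite mulr1 => /le_trans; apply; by rewrite ler_nat card_boundary1.
Qed.

End Poincare.

Lemma cheeger_boundary (R : realType) n (e : rel 'I_n) (g : R)
    (U : {set 'I_n}) :
  g <= cheeger R e -> (1 <= #|U|)%N -> (#|U|.*2 <= n)%N ->
  g * #|U|%:R <= #|boundary e U|%:R.
Proof.
move=> gc U1 Un; rewrite -ler_pdivlMr ?ltr0n//; apply: (le_trans gc).
apply: ge_inf.
  (* An infimum is a lower bound only for a set bounded below; here the quotients are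
     nonnegative. *)
  exists 0 => _ [V [_ _ ->]]; exact: divr_ge0.
exists U; split => //.
by rewrite ler_pdivlMr// -natrM ler_nat muln2.
Qed.

Local Open Scope classical_set_scope.
Local Open Scope ring_scope.

(** * Gaussian moments *)

Section Translation.
Context {R : realType}.
Local Notation RT := (measurableTypeR R).
Local Notation mu := (@lebesgue_measure R).
Local Open Scope ereal_scope.

(** By uniqueness of Lebesgue measure it is enough to compare the values on half-open intervals. *)
Lemma lebesgue_measure_translate (a : R) (A : set R) : measurable A ->
  pushforward mu ((fun x => x + a)%R : RT -> RT) A = mu A.
Proof.
move=> mA; have ma : measurable_fun setT ((fun x => x + a)%R : RT -> RT).
  by apply: measurable_funD => //; exact: measurable_cst.
(* The shift is packaged as a measurable function so that its pushforward is recognised as a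
   measure. *)
pose ma_mixin := isMeasurableFun.Build _ _ _ _ _ ma.
pose ma_pack : {mfun _ >-> _} :=
  HB.pack ((fun x => x + a)%R : RT -> RT) ma_mixin.
apply/esym; apply: (lebesgue_measure_unique (mu := pushforward mu ma_pack)) => //.
move=> _ [[u v]] _ <-.
have E : (fun x => x + a)%R @^-1` `]u, v] = `](u - a)%R, (v - a)%R]%classic.
  by apply/seteqP; split => x /=; rewrite !in_itv/= lerBrDr ltrBlDr.
rewrite -[RHS]/(mu ((fun x => x + a)%R @^-1` `]u, v])) E /=.
rewrite !lebesgue_measure_itv/= !lte_fin ltrD2r.
by case: ifP => // _; rewrite -!EFinD; congr EFin; ring.
Qed.

Lemma ge0_integral_translate (a : R) (f : RT -> \bar R) :
  measurable_fun setT f -> (forall x, 0 <= f x) ->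
  \int[mu]_x f (x + a)%R = \int[mu]_x f x.
Proof.
move=> mf f0; have ma : measurable_fun setT ((fun x => x + a)%R : RT -> RT).
  by apply: measurable_funD => //; exact: measurable_cst.
rewrite -(@ge0_integral_pushforward _ _ _ _ _ _ ma mu setT f)//.
by apply: eq_measure_integral => //= A mA _; exact: lebesgue_measure_translate.
Qed.

Definition tuple_add n (t w : n.-tuple R) : n.-tuple R :=
  [tuple (tnth t i + tnth w i)%R | i < n].

Lemma measurable_tuple_add n (w : n.-tuple R) :
  measurable_fun setT (fun t : n.-tuple RT => tuple_add t w : n.-tuple RT).
Proof.
apply/measurable_fun_tnthP => i.
rewrite (_ : _ \o _ = (fun t => tnth t i + tnth w i)%R).
  apply: measurable_funD; last exact: measurable_cst.
  exact: measurable_tnth.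
by apply/funext => t /=; rewrite tnth_mktuple.
Qed.

Lemma tuple_add_cons n (x : R) (t : n.-tuple R) (w : n.+1.-tuple R) :
  tuple_add [tuple of x :: t] w =
  [tuple of (x + thead w)%R :: tuple_add t [tuple of behead w]].
Proof.
apply/eq_from_tnth => i; rewrite tnth_mktuple.
case: (unliftP ord0 i) => [j|] ->; last by [].
rewrite !tnthS tnth_mktuple; congr (_ + _)%R.
by rewrite tnth_behead; congr tnth; apply: val_inj; rewrite /= inordK// ltnS.
Qed.

(** Tonelli: [leb R n.+1] is by definition the image of a product measure under [cons]. *)
Lemma ge0_integral_leb_cons n (f : n.+1.-tuple RT -> \bar R) :
  measurable_fun setT f -> (forall t, 0 <= f t) ->
  \int[leb R n.+1]_t f t =
  \int[mu]_x \int[leb R n]_t f [tuple of x :: t].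
Proof.
move=> mf f0.
have mc : measurable_fun setT
    (fun p : RT * n.-tuple RT => [tuple of p.1 :: p.2] : n.+1.-tuple RT).
  exact: measurable_cons.
transitivity (\int[(mu \x leb R n)%E]_p f [tuple of p.1 :: p.2]).
  exact: (@ge0_integral_pushforward _ _ _ _ _ _ mc (mu \x leb R n)%E setT f).
by rewrite fubini_tonelli1//; exact: measurableT_comp.
Qed.

Lemma ge0_integral_leb_translate n (w : n.-tuple R)
    (f : n.-tuple RT -> \bar R) :
  measurable_fun setT f -> (forall t, 0 <= f t) ->
  \int[leb R n]_t f (tuple_add t w) = \int[leb R n]_t f t.
Proof.
elim: n w f => [w f mf f0|n IH w f mf f0].
  by apply: eq_integral => t _; congr f; rewrite tuple0 [RHS]tuple0.
rewrite !ge0_integral_leb_cons//; last first.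
  apply: (measurableT_comp mf); exact: measurable_tuple_add.
have mfc x : measurable_fun setT (fun t : n.-tuple RT => f [tuple of x :: t]).
  apply: measurableT_comp => //; apply: measurable_cons => //.
under eq_integral => x _.
  under eq_integral => t _ do rewrite tuple_add_cons.
  rewrite (IH _ (fun t => f [tuple of (x + thead w)%R :: t]))//; over.
rewrite (ge0_integral_translate _
  (f := fun x => \int[leb R n]_t f [tuple of x :: t]))//.
- apply: (measurable_fun_fubini_tonelli_F (m2 := leb R n)
    (fun p : RT * n.-tuple RT => f [tuple of p.1 :: p.2])) => //.
  apply: measurableT_comp => //; exact: measurable_cons.
- by move=> x; exact: integral_ge0.
Qed.

End Translation.

(** * Expectations as integrals against the density *)

Section Density.
Context d (T : measurableType d) (R : realType) (P : probability T R) (n : nat).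
Context (X : {RV P >-> n.-tuple (measurableTypeR R)}).
Local Notation nu := (distribution P X).
Local Notation mu := (leb R n).
Local Open Scope ereal_scope.

(** [has_density] speaks of measures of sets only. It makes the law of [X] absolutely continuous,
    and the Radon-Nikodym derivative agrees almost everywhere with [p] because both have the same
    integral over every measurable set. *)
Lemma ge0_integral_density (p : 'rV[R]_n -> R)
    (f : n.-tuple (measurableTypeR R) -> \bar R) :
  has_density X p -> (forall x, 0 <= p x)%R ->
  measurable_fun setT
    (p \o @row_of_tuple R n : n.-tuple (measurableTypeR R) -> R) ->
  measurable_fun setT f -> (forall t, 0 <= f t) ->
  \int[P]_w f (X w) = \int[mu]_t (f t * (p (row_of_tuple t))%:E).
Proof.
move=> Xp p0 mp mf f0.
have mp' : measurable_fun setT (fun t : n.-tuple (measurableTypeR R) =>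
    (p (row_of_tuple t))%:E) by exact/measurable_EFinP.
have numu : nu `<< mu.
  apply/null_content_dominatesP => A mA A0; rewrite -[LHS]/(nu A) Xp//.
  by apply: null_set_integral => //; exact: measurable_funTS.
rewrite -(ge0_integral_distribution X mf f0).
rewrite -(Radon_Nikodym_SigmaFinite.change_of_variables numu)//.
apply: ae_eq_integral => //.
- apply: emeasurable_funM => //.
  exact: measurable_int (Radon_Nikodym_SigmaFinite.f_integrable _).
- by apply: emeasurable_funM.
apply: ae_eqe_mul2l; apply: integral_ae_eq => //.
  exact: Radon_Nikodym_SigmaFinite.f_integrable.
move=> E _ mE; rewrite -Radon_Nikodym_SigmaFinite.f_integral//.
exact: Xp.
Qed.

End Density.

(** * The moment generating function of a linear form *)

Section GaussianMgf.
Context {R : realType} {n : nat}.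
Local Notation RT := (measurableTypeR R).

(** Written as a matrix product so that the quadratic form in [gauss_density] is [dotv (x *m A) x]
    by conversion. *)
Definition dotv (v x : 'rV[R]_n) : R := (v *m x^T) 0 0.

Lemma dotvE v x : dotv v x = \sum_i v 0 i * x 0 i.
Proof. by rewrite /dotv mxE; apply: eq_bigr => i _; rewrite mxE. Qed.

Lemma dotvC v x : dotv v x = dotv x v.
Proof. by rewrite !dotvE; apply: eq_bigr => i _; rewrite mulrC. Qed.

Lemma dotvDl u v x : dotv (u + v) x = dotv u x + dotv v x.
Proof. by rewrite /dotv mulmxDl mxE. Qed.

Lemma dotvZl a v x : dotv (a *: v) x = a * dotv v x.
Proof. by rewrite /dotv -scalemxAl mxE. Qed.

Lemma dotvDr u v x : dotv x (u + v) = dotv x u + dotv x v.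
Proof. by rewrite !(dotvC x) dotvDl. Qed.

Lemma dotvZr a v x : dotv x (a *: v) = a * dotv x v.
Proof. by rewrite !(dotvC x) dotvZl. Qed.

Lemma dotvNl v x : dotv (- v) x = - dotv v x.
Proof. by rewrite /dotv mulNmx mxE. Qed.

Lemma dotvNr v x : dotv x (- v) = - dotv x v.
Proof. by rewrite !(dotvC x) dotvNl. Qed.

Lemma dotvM (A : 'M[R]_n) v x : dotv (v *m A) x = dotv v (x *m A^T).
Proof. by rewrite /dotv trmx_mul trmxK mulmxA. Qed.

Lemma measurable_row i :
  measurable_fun setT (fun t : n.-tuple RT => (row_of_tuple t : 'rV[R]_n) 0 i : R).
Proof.
by under eq_fun do rewrite mxE; exact: measurable_tnth.
Qed.

Lemma measurable_dotv v :
  measurable_fun setT (fun t : n.-tuple RT => dotv v (row_of_tuple t) : R).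
Proof.
under eq_fun do rewrite dotvE.
apply: measurable_sum => i; apply: measurable_funM => //.
exact: measurable_row.
Qed.

Lemma measurable_quad (A : 'M[R]_n) :
  measurable_fun setT
    (fun t : n.-tuple RT => dotv (row_of_tuple t *m A) (row_of_tuple t) : R).
Proof.
under eq_fun do rewrite dotvE.
apply: measurable_sum => i; apply: measurable_funM; last exact: measurable_row.
under eq_fun do rewrite mxE.
by apply: measurable_sum => j; apply: measurable_funM => //; exact: measurable_row.
Qed.

Lemma measurable_gauss_density (A : 'M[R]_n) :
  measurable_fun setT
    (gauss_density A \o @row_of_tuple R n : n.-tuple RT -> R).
Proof.
rewrite /comp /gauss_density.
apply: measurable_funM => //; apply: measurableT_comp => //.
apply: measurableT_comp => //; exact: measurable_quad.
Qed.

Lemma gauss_density_ge0 (A : 'M[R]_n) x : 0 <= gauss_density A x.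
Proof. by rewrite /gauss_density !mulr_ge0 ?powR_ge0 ?sqrtr_ge0 ?expR_ge0. Qed.

Lemma row_tuple_add (t w : n.-tuple R) :
  row_of_tuple (tuple_add t w) = row_of_tuple t + row_of_tuple w.
Proof. by apply/rowP => i; rewrite !mxE tnth_mktuple. Qed.

(* Completing the square turns the tilt by [v] into a translation by
   [v *m invmx (2 *: A)], so that the normalising constant plays no role. *)
Lemma gauss_mgf d (T : measurableType d) (P : probability T R)
    (X : {RV P >-> n.-tuple RT}) (A : 'M[R]_n) (v : 'rV[R]_n) :
  A^T = A -> A \in unitmx -> has_density X (gauss_density A) ->
  (\int[P]_w (expR (dotv v (row_of_tuple (X w))))%:E =
   (expR (dotv (v *m invmx (2 *: A)) v / 2))%:E)%E.
Proof.
move=> As Au Xp.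
have u2 : (2 : R) \is a GRing.unit by rewrite unitfE.
have A2u : 2 *: A \in unitmx by rewrite unitmxZ.
pose z := v *m invmx (2 *: A).
have zA : z *m A = 2^-1 *: v.
  by rewrite -[v in RHS](mulmxKV A2u v) -/z -scalemxAr scalerA mulVr// scale1r.
pose w : n.-tuple R := [tuple - z 0 i | i < n].
have wE : row_of_tuple w = - z :> 'rV[R]_n.
  by apply/rowP => i; rewrite [LHS]mxE [RHS]mxE tnth_mktuple.
have mm : measurable_fun setT (fun t : n.-tuple RT =>
  (expR (dotv v (row_of_tuple t)))%:E).
  apply/measurable_EFinP; apply: measurableT_comp => //; exact: measurable_dotv.
have mg : measurable_fun setT (fun t : n.-tuple RT =>
  (gauss_density A (row_of_tuple t))%:E).
  by apply/measurable_EFinP; exact: measurable_gauss_density.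
rewrite (ge0_integral_density (f := fun t : n.-tuple RT =>
  (expR (dotv v (row_of_tuple t)))%:E) Xp)//;
  [|exact: gauss_density_ge0|exact: measurable_gauss_density].
have mass1 : (\int[leb R n]_t (gauss_density A (row_of_tuple t))%:E = 1)%E.
  by rewrite -(Xp _ measurableT) probability_setT.
transitivity (\int[leb R n]_t ((expR (dotv z v / 2))%:E *
    (gauss_density A (row_of_tuple (tuple_add t w)))%:E))%E.
  apply: eq_integral => t _; rewrite -!EFinM; congr EFin.
  rewrite row_tuple_add wE /gauss_density mulrCA [RHS]mulrCA; congr (_ * _).
  rewrite -!expRD; congr expR; set x := row_of_tuple t.
  rewrite -![(_ *m _ *m _^T) 0 0]/(dotv _ _).
  rewrite mulmxBl zA !(dotvDl, dotvDr, dotvNl, dotvNr, dotvZl).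
  have -> : dotv (x *m A) z = 2^-1 * dotv v x.
    by rewrite dotvM As zA dotvZr dotvC.
  by rewrite (dotvC z v); field.
rewrite ge0_integralZl//.
- rewrite (ge0_integral_leb_translate w
    (f := fun t : n.-tuple RT => (gauss_density A (row_of_tuple t))%:E))//.
    by rewrite mass1 mule1.
  by move=> t; rewrite lee_fin gauss_density_ge0.
- apply: (measurableT_comp mg); exact: measurable_tuple_add.
- by move=> t _; rewrite lee_fin gauss_density_ge0.
Qed.

End GaussianMgf.

(** * Uniqueness of nonnegative power series coefficients *)

Section PowerSeries.
Context {R : realType}.
Implicit Types (a b : nat -> R) (s : R -> R).

(** For [u <= 1] every power beyond the [k]-th is at most [u ^+ k.+1], so the tail is at most
    [u ^+ k.+1] times the value at 1. *)
Lemma pseries_nth_bounds a s (k : nat) (u : R) :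
  (forall i, 0 <= a i) -> 0 < u <= 1 ->
  (forall u, 0 < u <= 1 -> series (fun i => a i * u ^+ i) @ \oo --> s u) ->
  a k * u ^+ k <= s u - \sum_(0 <= i < k) a i * u ^+ i
    <= a k * u ^+ k + u ^+ k.+1 * s 1.
Proof.
move=> a0 /andP[u0 u1] as_.
have u01 : 0 < u <= 1 by rewrite u0 u1.
have cu := as_ u u01; have c1 : _ --> s 1 := as_ 1 ltac:(by rewrite ltr01 lexx).
have split_sum N : (k < N)%N -> series (fun i => a i * u ^+ i) N =
    \sum_(0 <= i < k) a i * u ^+ i + a k * u ^+ k
    + \sum_(k.+1 <= i < N) a i * u ^+ i.
  move=> kN; rewrite /series/= (big_cat_nat (n := k.+1))//=.
  by rewrite big_nat_recr.
have mono x : 0 <= x -> nondecreasing_seq (series (fun i => a i * x ^+ i)).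
  move=> x0; apply/nondecreasing_seqP => N; rewrite /series/= big_nat_recr//=.
  by rewrite lerDl mulr_ge0// exprn_ge0.
have le1 N : series (fun i => a i * 1 ^+ i) N <= s 1.
  rewrite -(cvg_lim _ c1)//; apply: nondecreasing_cvgn_le; first exact: mono.
  by apply/cvg_ex; exists (s 1).
apply/andP; split.
  rewrite lerBrDr; apply: (@le_trans _ _ (series (fun i => a i * u ^+ i) k.+1)).
    by rewrite split_sum// [X in _ <= _ + _ + X]big_geq// addr0 addrC.
  rewrite -(cvg_lim _ cu)//; apply: nondecreasing_cvgn_le; first exact/mono/ltW.
  by apply/cvg_ex; exists (s u).
rewrite lerBlDr -(cvg_lim _ cu)//; apply: limr_le; first by apply/cvg_ex;
  exists (s u).
near=> N; have kN : (k < N)%N by near: N; exists k.+1.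
rewrite split_sum// [leRHS]addrC addrA lerD2l.
apply: (@le_trans _ _ (u ^+ k.+1 * series (fun i => a i * 1 ^+ i) N)); last first.
  by rewrite ler_wpM2l ?exprn_ge0 ?(ltW u0).
rewrite /series/= [leRHS](_ : _ = \sum_(0 <= i < N) u ^+ k.+1 * a i); last first.
  by rewrite mulr_sumr; apply: eq_bigr => i _; rewrite expr1n mulr1.
rewrite [leRHS](big_cat_nat (n := k.+1))//=.
rewrite -[leLHS]add0r lerD//.
  by rewrite sumr_ge0// => i _; rewrite mulr_ge0// exprn_ge0// ltW.
rewrite big_nat_cond [leRHS]big_nat_cond; apply: ler_sum => i /andP[/andP[ki _] _].
rewrite mulrC ler_wpM2r//.
by apply: ler_wiXn2l => //; exact: ltW.
Unshelve. all: by end_near. Qed.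

(** If the coefficients below [k] agree, [pseries_nth_bounds] puts [a k] and [b k] within [u * s 1]
    of each other, and [u] can be taken small. Only positive arguments occur, so the square of a
    real parameter may be substituted for [u]. *)
Lemma pseries_coef_unique a b s :
  (forall i, 0 <= a i) -> (forall i, 0 <= b i) ->
  (forall u, 0 < u <= 1 -> series (fun i => a i * u ^+ i) @ \oo --> s u) ->
  (forall u, 0 < u <= 1 -> series (fun i => b i * u ^+ i) @ \oo --> s u) ->
  forall k, a k = b k.
Proof.
move=> a0 b0 as_ bs; elim/ltn_ind => k IH.
have key u : 0 < u <= 1 -> `|a k - b k| <= u * `|s 1|.
  move=> u01; have /andP[u0 u1] := u01.
  have /andP[al ar] := pseries_nth_bounds k a0 u01 as_.
  have /andP[bl br] := pseries_nth_bounds k b0 u01 bs.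
  have E : \sum_(0 <= i < k) a i * u ^+ i = \sum_(0 <= i < k) b i * u ^+ i.
    by apply: eq_big_nat => i /andP[_ ik]; rewrite IH.
  rewrite E in al ar.
  have uk : 0 < u ^+ k by rewrite exprn_gt0.
  have s1 : u ^+ k.+1 * s 1 <= u ^+ k * (u * `|s 1|).
    by rewrite exprSr -mulrA ler_wpM2l ?(ltW uk)// ler_wpM2l ?(ltW u0)// ler_norm.
  rewrite -(ler_pM2l uk) -[X in X * `|_|]gtr0_norm// -normrM mulrBr.
  rewrite ler_norml; rewrite !(mulrC (u ^+ k) (_ k)); lra.
apply/eqP; rewrite -subr_eq0 -normr_le0 leNgt; apply/negP => h.
have s1 : 0 <= `|s 1| by [].
pose e := `|a k - b k|; rewrite -/e in h key.
(* With this [u], the bound [u * |s 1|] stays below half of the supposed gap [e]; the minimum with 1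
   keeps [u] where the series is known to converge. *)
pose u := Num.min 1 (e / (2 * (`|s 1| + 1))).
have u01 : 0 < u <= 1.
  rewrite /u lt_min ltr01 ge_min lexx/= andbT divr_gt0//; lra.
have := key _ u01; apply/negP; rewrite -ltNge.
have : u * (2 * (`|s 1| + 1)) <= e.
  by rewrite -ler_pdivlMr ?ge_min ?lexx ?orbT//; lra.
have /andP[u0 _] := u01.
nra.
Qed.

End PowerSeries.

(** * Even moments from the moment generating function *)

Section EvenMoments.
Context {R : realType}.

Lemma series_exp_coeff (x : R) : series (exp_coeff x) @ \oo --> expR x.
Proof. exact: is_cvg_series_exp_coeff. Qed.

(** The odd terms cancel: the [N]-th partial sum is the average of the partial sums of length [2N]
    of the two exponential series. *)
Lemma series_cosh (y : R) :
  series (fun k => y ^+ k.*2 / (k.*2)`!%:R) @ \oo -->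
  (expR y + expR (- y)) / 2.
Proof.
have -> : series (fun k => y ^+ k.*2 / (k.*2)`!%:R) =
    (fun N => (series (exp_coeff y) N + series (exp_coeff (- y)) N) / 2) \o double.
  apply/funext; elim => [|N IH].
    by rewrite /series/= !big_geq// addr0 mul0r.
  rewrite seriesSr IH /= doubleS !seriesSr.
  have e : (- y) ^+ N.*2 = y ^+ N.*2 by rewrite -mul2n !exprM sqrrN.
  rewrite /exp_coeff /= !exprS e !mulNr; field.
  by rewrite !pnatr_eq0 -!lt0n !fact_gt0.
have cd : double @ \oo --> \oo.
  move=> A [N _ NA]; exists N => // k /= Nk; apply: NA => /=.
  by rewrite (leq_trans Nk)// -addnn leq_addr.
apply: (cvg_comp _ _ cd); apply: cvgMl.
apply: cvgD; exact: series_exp_coeff.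
Qed.

Lemma ge0_nneseries_cvg (a : nat -> R) (s : R) :
  (forall i, 0 <= a i) -> (\sum_(i <oo) (a i)%:E = s%:E)%E ->
  series a @ \oo --> s.
Proof.
move=> a0 as_.
have : (fun N => \sum_(0 <= i < N) (a i)%:E)%E @ \oo --> s%:E.
  rewrite -as_; apply: is_cvg_nneseries => i _ _; by rewrite lee_fin.
under eq_fun do rewrite sumEFin.
by move/fine_cvgP => [].
Qed.

Lemma cvg_nneseries_fin (a : nat -> R) (s : R) :
  (forall i, 0 <= a i) -> series a @ \oo --> s ->
  (\sum_(i <oo) (a i)%:E = s%:E)%E.
Proof.
move=> a0 as_; apply/cvg_lim => //.
under eq_fun do rewrite sumEFin.
by apply/fine_cvgP; split; first exact: nearW.
Qed.

(** Averaging over [s] and [- s] leaves the series of cosh, whose terms are nonnegative; sum and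
    integral may then be exchanged before any moment is known to be finite. Coefficients are
    compared in the variable [s ^+ 2]. *)
Lemma mgf_even_moments d (T : measurableType d) (P : probability T R)
    (Y : T -> R) (c : R) : 0 <= c -> measurable_fun setT Y ->
  (forall s, \int[P]_w (expR (s * Y w))%:E = (expR (s ^+ 2 * c / 2))%:E)%E ->
  forall k, (\int[P]_w (Y w ^+ k.*2)%:E =
    ((k.*2)`!%:R / (2 ^+ k * k`!%:R) * c ^+ k)%:E)%E.
Proof.
move=> c0 mY mgf.
have Yk0 w k : 0 <= Y w ^+ k.*2 by rewrite -mul2n exprM exprn_ge0// sqr_ge0.
have mYk k : measurable_fun setT (fun w => (Y w ^+ k)%:E).
  by apply/measurable_EFinP; exact: measurable_funX.
have fact0 k : 0 < k`!%:R :> R by rewrite ltr0n fact_gt0.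
pose m k := (\int[P]_w (Y w ^+ k.*2)%:E)%E.
have m0 k : (0 <= m k)%E by apply: integral_ge0 => w _; rewrite lee_fin.
have cosh_int s : (\sum_(k <oo) ((s ^+ k.*2 / (k.*2)`!%:R)%:E * m k) =
    (expR (s ^+ 2 * c / 2))%:E)%E.
  have sk0 k : 0 <= s ^+ k.*2 / (k.*2)`!%:R.
    by rewrite divr_ge0// -mul2n exprM exprn_ge0// sqr_ge0.
  transitivity (\sum_(k <oo) \int[P]_w ((s * Y w) ^+ k.*2 / (k.*2)`!%:R)%:E)%E.
    apply: eq_eseriesr => k _; rewrite -ge0_integralZl_EFin//; last first.
      by move=> w _; rewrite lee_fin.
    by apply: eq_integral => w _; rewrite -EFinM exprMn mulrAC.
  rewrite -integral_nneseries//; last 2 first.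
  - move=> k; apply/measurable_EFinP; apply: measurable_funM => //.
    by apply: measurable_funX; exact: measurable_funM.
  - by move=> k w _; rewrite lee_fin exprMn mulrAC mulr_ge0.
  transitivity (\int[P]_w ((2^-1)%:E * ((expR (s * Y w))%:E +
    (expR (- s * Y w))%:E)))%E.
    apply: eq_integral => w _; rewrite -EFinD -EFinM; apply: cvg_nneseries_fin.
      by move=> k; rewrite exprMn mulrAC mulr_ge0.
    rewrite [X in _ --> X]mulrC mulNr; exact: series_cosh.
  have me t : measurable_fun setT (fun w => (expR (t * Y w))%:E).
    by apply/measurable_EFinP; apply: measurableT_comp => //;
      exact: measurable_funM.
  rewrite ge0_integralZl//; last 2 first.
  - by apply: emeasurable_funD.
  - by move=> w _; rewrite -EFinD lee_fin addr_ge0 ?expR_ge0.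
  rewrite ge0_integralD//.
  by rewrite !mgf sqrrN -EFinD -EFinM; congr EFin; field.
(* Every term of the series at [s = 1] is at most its sum, which is finite. *)
have mfin k : m k \is a fin_num.
  rewrite ge0_fin_numE//.
  have := cosh_int 1; rewrite (nneseries_split 0 k.+1); last first.
    by move=> i _; rewrite mule_ge0// lee_fin expr1n.
  rewrite add0n big_nat_recr//= => E.
  have : ((1 ^+ k.*2 / (k.*2)`!%:R)%:E * m k < +oo)%E.
    rewrite (@le_lt_trans _ _ (expR (1 ^+ 2 * c / 2))%:E)// ?ltry//.
    rewrite -E -addeA addeCA leeDl// adde_ge0//.
      by apply: sume_ge0 => i _; rewrite mule_ge0// lee_fin expr1n.
    by apply: nneseries_ge0 => i _ _; rewrite mule_ge0// lee_fin expr1n.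
  rewrite expr1n; move: (m0 k); case: (m k) => [r|//|//]; rewrite ?ltry//.
  by rewrite gt0_muley// lte_fin divr_gt0.
have mE k : m k = (fine (m k))%:E by rewrite fineK.
have fm0 k : 0 <= fine (m k) by rewrite fine_ge0.
pose a k := fine (m k) / (k.*2)`!%:R.
pose b k := (c / 2) ^+ k / k`!%:R.
have ab : forall k, a k = b k.
  apply: (@pseries_coef_unique _ _ _ (fun u => expR (c / 2 * u))).
  - by move=> k; rewrite divr_ge0.
  - by move=> k; rewrite divr_ge0// exprn_ge0// divr_ge0.
  - move=> u /andP[u0 _].
    have := cosh_int (Num.sqrt u); rewrite sqr_sqrtr ?(ltW u0)// => E.
    apply: ge0_nneseries_cvg.
      by move=> i; rewrite mulr_ge0 ?exprn_ge0 ?(ltW u0)// divr_ge0.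
    rewrite [c / 2 * u]mulrC mulrA -E; apply: eq_eseriesr => k _.
    rewrite [in RHS]mE -EFinM; congr EFin.
    by rewrite -[in RHS]mul2n exprM sqr_sqrtr ?(ltW u0)// mul2n /a; ring.
  - move=> u _; rewrite (_ : (fun i => _) = exp_coeff (c / 2 * u)).
      exact: series_exp_coeff.
    by apply/funext => k; rewrite /exp_coeff/= exprMn mulrAC.
move=> k; rewrite -[LHS]/(m k) mE; congr EFin.
have := ab k; rewrite /a /b => /(canRL (divfK (lt0r_neq0 (fact0 k.*2)))) ->.
rewrite exprMn exprVn; field.
by rewrite !(lt0r_neq0 (fact0 _)) expf_neq0.
Qed.

End EvenMoments.

(** * Calculus of means *)

Section HasMean.
Context d (T : measurableType d) (R : realType) (P : probability T R).
Implicit Types (f g : T -> R) (m c : R).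

(** Integrability is bundled with the value, so that linear combinations of moments carry their side
    conditions along. *)
Definition has_mean f m :=
  P.-integrable setT (EFin \o f) /\ (\int[P]_w (f w)%:E = m%:E)%E.

Lemma has_mean_ext f g m m' : f =1 g -> m = m' -> has_mean f m -> has_mean g m'.
Proof. by move=> /funext -> ->. Qed.

Lemma has_meanD f g m m' :
  has_mean f m -> has_mean g m' -> has_mean (fun w => f w + g w) (m + m').
Proof.
move=> [fi fm] [gi gm]; split.
  by rewrite (_ : _ \o _ = (EFin \o f) \+ (EFin \o g))%E//; exact: integrableD.
by under eq_integral do rewrite EFinD; rewrite integralD// fm gm.
Qed.

Lemma has_meanZ c f m : has_mean f m -> has_mean (fun w => c * f w) (c * m).
Proof.
move=> [fi fm]; split.
  by rewrite (_ : _ \o _ = (fun w => c%:E * (EFin \o f) w))%E//;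
    exact: integrableZl.
by under eq_integral do rewrite EFinM; rewrite integralZl// fm.
Qed.

Lemma has_mean0 : has_mean (fun=> 0) 0.
Proof. by split; [exact: integrable0|rewrite integral0]. Qed.

Lemma has_mean_sum (I : Type) (s : seq I) (p : pred I)
    (F : I -> T -> R) (m : I -> R) :
  (forall i, p i -> has_mean (F i) (m i)) ->
  has_mean (fun w => \sum_(i <- s | p i) F i w) (\sum_(i <- s | p i) m i).
Proof.
move=> FM; elim: s => [|i s IH].
  by apply: (has_mean_ext _ _ has_mean0) => [w|]; rewrite big_nil.
have [pi|pi] := boolP (p i).
  apply: (has_mean_ext _ _ (has_meanD (FM i pi) IH)) => [w|];
  by rewrite big_cons pi.
by apply: (has_mean_ext _ _ IH) => [w|]; rewrite big_cons (negbTE pi).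
Qed.

Lemma ge0_has_mean f m : measurable_fun setT f -> (forall w, 0 <= f w) ->
  (\int[P]_w (f w)%:E = m%:E)%E -> has_mean f m.
Proof.
move=> mf f0 fm; split => //; apply/integrableP; split.
  exact/measurable_EFinP.
under eq_integral do rewrite /= ger0_norm//.
by rewrite fm ltry.
Qed.

Lemma expectation_has_mean f m : has_mean f m -> ('E_P[f] = m%:E)%E.
Proof. by rewrite unlock => -[]. Qed.

Lemma variance_has_mean f m m2 : has_mean f m -> has_mean (fun w => f w ^+ 2) m2 ->
  ('V_P[f] = (m2 - m ^+ 2)%:E)%E.
Proof.
move=> fm fm2; have [fi _] := fm; have [f2i _] := fm2.
rewrite /variance covarianceE; last first.
- exact/Lfun1_integrable.
- exact/Lfun1_integrable.
- exact/Lfun1_integrable.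
have -> : f * f = fun w => f w ^+ 2 by apply/funext => w; rewrite fctE expr2.
by rewrite (expectation_has_mean fm) (expectation_has_mean fm2).
Qed.

Lemma has_mean_of_sqr f m2 : measurable_fun setT f ->
  has_mean (fun w => f w ^+ 2) m2 -> exists m, has_mean f m.
Proof.
move=> mf [f2i _].
have fi : P.-integrable setT (EFin \o f).
  apply: (@le_integrable _ _ _ P _ measurableT _ (fun w =>
    1 + (f w ^+ 2)%:E)%E) => //.
  - exact/measurable_EFinP.
  - move=> w _; rewrite /= lee_fin [leRHS]ger0_norm ?addr_ge0 ?sqr_ge0//.
    by rewrite -(real_normK (num_real (f w))); have := sqr_ge0 (`|f w| - 1); nra.
  - apply: integrableD => //.
    exact: finite_measure_integrable_cst.
exists (fine (\int[P]_w (f w)%:E)%E); split => //.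
by rewrite fineK// integrable_fin_num.
Qed.

(** The square of the mean is dropped, so the mean need not be computed. This suits f3, whose mean
    involves odd moments; integrability follows from [|f| <= 1 + f ^+ 2]. *)
Lemma variance_le_sqr f m2 : measurable_fun setT f ->
  has_mean (fun w => f w ^+ 2) m2 -> (`|'V_P[f]| <= m2%:E)%E.
Proof.
move=> mf fm2; have [m fm] := has_mean_of_sqr mf fm2.
rewrite gee0_abs ?variance_ge0// (variance_has_mean fm fm2) lee_fin.
by rewrite gerBl sqr_ge0.
Qed.

End HasMean.

(** * Moments of linear forms and of their power sums *)

Section GaussianMoments.
Context d (T : measurableType d) (R : realType) (P : probability T R) (n : nat).
Context (X : {RV P >-> n.-tuple (measurableTypeR R)}) (A : 'M[R]_n).
Hypotheses (As : A^T = A) (Au : A \in unitmx).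
Hypothesis Xp : has_density X (gauss_density A).

Definition gcov (u v : 'rV[R]_n) : R := dotv (u *m invmx (2 *: A)) v.
Hypothesis gcov_ge0 : forall v, 0 <= gcov v v.

Let Y v w := dotv v (row_of_tuple (X w)).

Lemma gcovC u v : gcov u v = gcov v u.
Proof. by rewrite /gcov dotvM trmx_inv linearZ/= As dotvC. Qed.

Lemma gcovDl u v x : gcov (u + v) x = gcov u x + gcov v x.
Proof. by rewrite /gcov mulmxDl dotvDl. Qed.

Lemma gcovZl a v x : gcov (a *: v) x = a * gcov v x.
Proof. by rewrite /gcov -scalemxAl dotvZl. Qed.

Lemma gcovDr u v x : gcov x (u + v) = gcov x u + gcov x v.
Proof. by rewrite !(gcovC x) gcovDl. Qed.

Lemma gcovZr a v x : gcov x (a *: v) = a * gcov x v.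
Proof. by rewrite !(gcovC x) gcovZl. Qed.

Lemma measurable_linear_form v : measurable_fun setT (Y v).
Proof.
by apply: (measurableT_comp (measurable_dotv v)); exact: measurable_funPT.
Qed.

Lemma even_moment v k : has_mean P (fun w => Y v w ^+ k.*2)
  ((k.*2)`!%:R / (2 ^+ k * k`!%:R) * gcov v v ^+ k).
Proof.
apply: ge0_has_mean.
- exact/measurable_funX/measurable_linear_form.
- by move=> w; rewrite -mul2n exprM exprn_ge0// sqr_ge0.
apply: mgf_even_moments => // [|s]; first exact: measurable_linear_form.
rewrite /Y; under eq_integral do rewrite -dotvZl.
rewrite (gauss_mgf _ As Au Xp) -[dotv (_ *m _) _]/(gcov _ _) gcovZl gcovZr.
by rewrite mulrA expr2.
Qed.

Lemma moment4 v : has_mean P (fun w => Y v w ^+ 4) (3 * gcov v v ^+ 2).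
Proof.
apply: (has_mean_ext _ _ (even_moment v 2)) => //.
by congr (_ * _); rewrite !factS fact0; field.
Qed.

Lemma moment6 v : has_mean P (fun w => Y v w ^+ 6) (15 * gcov v v ^+ 3).
Proof.
apply: (has_mean_ext _ _ (even_moment v 3)) => //.
by congr (_ * _); rewrite !factS fact0; field.
Qed.

Lemma moment8 v : has_mean P (fun w => Y v w ^+ 8) (105 * gcov v v ^+ 4).
Proof.
apply: (has_mean_ext _ _ (even_moment v 4)) => //.
by congr (_ * _); rewrite !factS fact0; field.
Qed.

Let YD u v a w : Y (u + a *: v) w = Y u w + a * Y v w.
Proof. by rewrite /Y dotvDl dotvZl. Qed.

Let gcov_pencil u v a : gcov (u + a *: v) (u + a *: v) =
  gcov u u + 2 * a * gcov u v + a ^+ 2 * gcov v v.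
Proof. by rewrite !gcovDl !gcovDr !gcovZl !gcovZr (gcovC v u); ring. Qed.

(* Polarisation: the coefficients are those of the Lagrange interpolation at
   the nodes [1], [4], [9] of the odd part in [a] of [(y + a z) ^+ 6]. *)
Lemma moment33 u v : has_mean P (fun w => Y u w ^+ 3 * Y v w ^+ 3)
  (9 * gcov u u * gcov v v * gcov u v + 6 * gcov u v ^+ 3).
Proof.
have M a c := has_meanZ c (moment6 (u + a *: v)).
have := has_meanD (has_meanD (has_meanD (M 1 (- (13 / 960))) (M (- 1) (13 / 960)))
  (has_meanD (M 2 (1 / 120)) (M (- 2) (- (1 / 120)))))
  (has_meanD (M 3 (- (1 / 960))) (M (- 3) (1 / 960))).
apply: has_mean_ext => [w|]; last by rewrite !gcov_pencil; field.
by rewrite !YD; field.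
Qed.

(* The same interpolation, for the even part of [(y + a z) ^+ 8] without its
   extreme terms [y ^+ 8] and [a ^+ 8 * z ^+ 8]. *)
Lemma moment44 u v : has_mean P (fun w => Y u w ^+ 4 * Y v w ^+ 4)
  (9 * gcov u u ^+ 2 * gcov v v ^+ 2 + 72 * gcov u u * gcov v v * gcov u v ^+ 2
   + 24 * gcov u v ^+ 4).
Proof.
have M a c := has_meanZ c (moment8 (u + a *: v)).
have := has_meanD (has_meanD (has_meanD (M 1 (- (13 / 3360))) (M (- 1) (- (13 /
  3360))))
  (has_meanD (M 2 (1 / 840)) (M (- 2) (1 / 840))))
  (has_meanD (has_meanD (M 3 (- (1 / 10080))) (M (- 3) (- (1 / 10080))))
  (has_meanD (has_meanZ (7 / 1260) (moment8 u)) (has_meanZ (7 / 10) (moment8 v)))).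
apply: has_mean_ext => [w|]; last by rewrite !gcov_pencil; field.
by rewrite !YD; field.
Qed.

Section LinearCombinations.
Context (I : finType) (E : {set I}) (a : I -> R) (v : I -> 'rV[R]_n).
Local Notation c i j := (gcov (v i) (v j)).

Lemma mean_sum4 : has_mean P (fun w => \sum_(i in E) a i * Y (v i) w ^+ 4)
  (\sum_(i in E) a i * (3 * c i i ^+ 2)).
Proof. by apply: has_mean_sum => i _; exact/has_meanZ/moment4. Qed.

Lemma mean_sum6 : has_mean P (fun w => \sum_(i in E) a i * Y (v i) w ^+ 6)
  (\sum_(i in E) a i * (15 * c i i ^+ 3)).
Proof. by apply: has_mean_sum => i _; exact/has_meanZ/moment6. Qed.

Lemma mean_sqr_sum3 :
  has_mean P (fun w => (\sum_(i in E) a i * Y (v i) w ^+ 3) ^+ 2)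
  (\sum_(i in E) \sum_(j in E)
    a i * a j * (9 * c i i * c j j * c i j + 6 * c i j ^+ 3)).
Proof.
have : has_mean P (fun w => \sum_(i in E) \sum_(j in E)
    a i * a j * (Y (v i) w ^+ 3 * Y (v j) w ^+ 3))
  (\sum_(i in E) \sum_(j in E)
    a i * a j * (9 * c i i * c j j * c i j + 6 * c i j ^+ 3)).
  apply: has_mean_sum => i _; apply: has_mean_sum => j _.
  exact/has_meanZ/moment33.
apply: has_mean_ext => // w; rewrite expr2 mulr_suml; apply: eq_bigr => i _.
by rewrite mulr_sumr; apply: eq_bigr => j _; ring.
Qed.

(** The first term of [moment44] is the product of the two fourth moments and cancels against the
    squared mean, so that every remaining term contains [c i j ^+ 2]. *)
Lemma variance_sum4 :
  ('V_P[(fun w => \sum_(i in E) a i * Y (v i) w ^+ 4)%R] =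
   (\sum_(i in E) \sum_(j in E)
      a i * a j * (72 * c i i * c j j * c i j ^+ 2 + 24 * c i j ^+ 4))%R%:E)%E.
Proof.
have : has_mean P (fun w => (\sum_(i in E) a i * Y (v i) w ^+ 4) ^+ 2)
  (\sum_(i in E) \sum_(j in E) a i * a j * (9 * c i i ^+ 2 * c j j ^+ 2
    + 72 * c i i * c j j * c i j ^+ 2 + 24 * c i j ^+ 4)).
  have : has_mean P (fun w => \sum_(i in E) \sum_(j in E)
      a i * a j * (Y (v i) w ^+ 4 * Y (v j) w ^+ 4))
    (\sum_(i in E) \sum_(j in E) a i * a j * (9 * c i i ^+ 2 * c j j ^+ 2
      + 72 * c i i * c j j * c i j ^+ 2 + 24 * c i j ^+ 4)).
    apply: has_mean_sum => i _; apply: has_mean_sum => j _.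
    exact/has_meanZ/moment44.
  apply: has_mean_ext => // w; rewrite expr2 mulr_suml; apply: eq_bigr => i _.
  by rewrite mulr_sumr; apply: eq_bigr => j _; ring.
move=> /(variance_has_mean mean_sum4) ->; congr EFin.
rewrite expr2 mulr_suml -sumrB; apply: eq_bigr => i _.
by rewrite mulr_sumr -sumrB; apply: eq_bigr => j _; ring.
Qed.

End LinearCombinations.

End GaussianMoments.

(** * Covariances of the increments *)

Section Coercive.
Context {R : realType} {n : nat}.
Variables (M : 'M[R]_n) (k : R).
Hypothesis k0 : 0 < k.
Hypothesis Mk : forall x : 'rV[R]_n, k * dotv x x <= dotv (x *m M) x.
Local Notation S := (invmx M).
Implicit Types x y u v : 'rV[R]_n.

Lemma dotvv_ge0 x : 0 <= dotv x x.
Proof. by rewrite dotvE sumr_ge0// => i _; rewrite -expr2 sqr_ge0. Qed.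

Lemma dotvv_eq0 x : dotv x x = 0 -> x = 0.
Proof.
rewrite dotvE => /eqP; rewrite psumr_eq0 => [|i _]; last by rewrite -expr2 sqr_ge0.
move=> /allP x0; apply/rowP => i; rewrite mxE.
by have := x0 i; rewrite mem_index_enum => /(_ isT)/=;
  rewrite mulf_eq0 orbb => /eqP.
Qed.

Lemma dotv_amgm (a : R) u v : 0 < a ->
  2 * `|dotv u v| <= dotv u u / a + a * dotv v v.
Proof.
move=> a0.
have H b : b ^+ 2 = 1 -> 2 * (b * dotv u v) <= dotv u u / a + a * dotv v v.
  move=> b1; have := dotvv_ge0 (u - (a * b) *: v).
  rewrite !(dotvDl, dotvDr, dotvNl, dotvNr, dotvZl, dotvZr) (dotvC v u) => h.
  rewrite -(ler_pM2l a0).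
  have -> : a * (dotv u u / a + a * dotv v v) = dotv u u + a * (a * dotv v v).
    by field; rewrite gt_eqF.
  have -> : a * (2 * (b * dotv u v)) = 2 * (a * b * dotv u v) by ring.
  have -> : a * (a * dotv v v) = a * b * (a * b * dotv v v).
    have -> : a * b * (a * b * dotv v v) = b ^+ 2 * (a * (a * dotv v v)) by ring.
    by rewrite b1 mul1r.
  lra.
have H1 := H 1 (expr1n _ _); have HN := H (- 1) (etrans (sqrrN 1) (expr1n _ _)).
by case: (ger0P (dotv u v)) => _; [rewrite mul1r in H1|rewrite mulN1r in HN].
Qed.

Lemma coercive_unit : M \in unitmx.
Proof.
rewrite -row_free_unit -kermx_eq0; apply/eqP/row_matrixP => i; rewrite row0.
apply: dotvv_eq0; apply/eqP; rewrite eq_le dotvv_ge0 andbT.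
rewrite -(pmulr_rle0 _ k0); apply: (le_trans (Mk _)).
by rewrite -row_mul mulmx_ker row0 dotvE big1// => j _; rewrite mxE mul0r.
Qed.

Lemma inv_quad u : dotv (u *m S *m M) (u *m S) = dotv (u *m S) u.
Proof. by rewrite mulmxKV ?coercive_unit// dotvC. Qed.

Lemma inv_ge0 u : 0 <= dotv (u *m S) u.
Proof.
rewrite -inv_quad; apply: le_trans (Mk _); apply: mulr_ge0; first exact: ltW.
exact: dotvv_ge0.
Qed.

(** By coercivity, [k] times the squared norm of [u *m S] is at most its product with [u]; AM-GM
    bounds this by half of both sides of the claim. *)
Lemma inv_norm u : k * dotv (u *m S) (u *m S) <= dotv u u / k.
Proof.
have := Mk (u *m S); rewrite inv_quad.
have := dotv_amgm u (u *m S) k0; have := ler_norm (dotv u (u *m S)).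
by rewrite (dotvC (u *m S) u); lra.
Qed.

(** An arithmetic mean of squared norms stands where Cauchy-Schwarz would give a geometric one; the
    vectors to which this is applied have comparable norms. *)
Lemma inv_le u v : `|dotv (u *m S) v| <= (dotv u u + dotv v v) / (2 * k).
Proof.
have := dotv_amgm v (u *m S) k0; rewrite (dotvC v); have := inv_norm u.
have -> : (dotv u u + dotv v v) / (2 * k) = (dotv u u / k + dotv v v / k) / 2.
  by field; rewrite gt_eqF.
lra.
Qed.

End Coercive.

(** * The weighted Laplacian and its inverse *)

Section Laplacian.
Context {R : realType} {n : nat}.
Variables (e : rel 'I_n) (r : 'I_n -> R) (w0 gamma : R).
Implicit Types (x u v : 'rV[R]_n) (p q : 'I_n * 'I_n).
Hypotheses (se : simple_graph e) (n1 : (1 < n)%N).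
Hypotheses (w00 : 0 < w0) (gamma0 : 0 < gamma).
Local Notation D := ((maxdeg e)%:R : R).
Hypothesis D0 : 0 < D.
Hypothesis Dn : D <= n%:R.
Hypothesis hU : forall U : {set 'I_n}, (1 <= #|U|)%N -> (#|U|.*2 <= n)%N ->
  gamma * D * #|U|%:R <= #|boundary e U|%:R.

(** The edge weights of the Laplacian part of [2 *: Amx e r], equal to 1 when [r j = r k]. *)
Definition wt j k := 4 * (lam r j k * lam r k j).
Hypothesis w_bounds : forall j k, e j k -> w0 <= wt j k <= 1.

Let n0 : 0 < n%:R :> R. Proof. by rewrite ltr0n ltnW. Qed.

Definition wdeg j := \sum_(l | e j l) wt j l.

Local Notation M := (2 *: Amx e r).
Local Notation S := (invmx M).

Lemma Amx_sym : (Amx e r)^T = Amx e r.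
Proof.
have [Ls _ _] := LmxP r se.
by rewrite /Amx linearD linearZ/= Ls; congr (_ *: _ + _); apply/matrixP => i j;
  rewrite !mxE.
Qed.

Lemma Mx_sym : M^T = M.
Proof. by rewrite linearZ/= Amx_sym. Qed.

Lemma Mx_entry j k : M j k = 2 * D / n%:R +
  (if j == k then wdeg j else if e j k then - wt j k else 0).
Proof.
rewrite !mxE mulr1 mulrDr mulrA; congr (_ + _).
case: eqVneq => _; first by rewrite mulrA /wdeg /wt mulr_sumr;
  apply: eq_bigr => l _; ring.
by case: ifP => _; rewrite ?mulr0// /wt; ring.
Qed.

Lemma Mx_quad x : dotv (x *m M) x =
  2 * D / n%:R * (\sum_i x 0 i) ^+ 2 +
  \sum_(p in edges e) wt p.1 p.2 * (x 0 p.1 - x 0 p.2) ^+ 2.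
Proof.
have [_ Lq _] := LmxP r se.
rewrite -scalemxAr dotvZl /Amx mulmxDr dotvDl {2}/dotv Lq -scalemxAr dotvZl.
rewrite mulrDr; congr (_ + _); last first.
  by rewrite /Lquad !mulr_sumr; apply: eq_bigr => p _; rewrite /wt; ring.
rewrite -!mulrA; do 3 congr (_ * _).
rewrite dotvE expr2 mulr_sumr; apply: eq_bigr => i _; congr (_ * _).
by rewrite mxE; apply: eq_bigr => j _; rewrite mxE mulr1.
Qed.

Lemma w_edges p : p \in edges e -> w0 <= wt p.1 p.2 <= 1.
Proof. by rewrite inE => /andP[_ /w_bounds]. Qed.

Lemma energy_le_quad x : w0 * energy e (x 0) <= dotv (x *m M) x.
Proof.
rewrite Mx_quad -[leLHS]add0r lerD//.
  by rewrite mulr_ge0 ?sqr_ge0// divr_ge0 ?(ltW n0)// mulr_ge0// ltW.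
rewrite mulr_sumr; apply: ler_sum => p pe; apply: ler_wpM2r; first exact: sqr_ge0.
by have /andP[] := w_edges pe.
Qed.

(** The all-ones part contributes [2 * D] on constant vectors; on vectors of sum zero, [poincare]
    and the lower bound [w0] on the weights contribute the other value times [D]. *)
Definition kappa := Num.min 2 (w0 * gamma ^+ 2 / 2).

Lemma kappa_gt0 : 0 < kappa.
Proof. by rewrite lt_min ltr0n/= divr_gt0// mulr_gt0// exprn_gt0. Qed.

Lemma Mx_coercive x : kappa * D * dotv x x <= dotv (x *m M) x.
Proof.
have q0 : 0 <= energy e (x 0) by rewrite sumr_ge0// => p _; exact: sqr_ge0.
have P := poincare se gamma0 hU (x 0) (ltnW n1).
have E : w0 * energy e (x 0) + 2 * D / n%:R * (\sum_i x 0 i) ^+ 2 <=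
  dotv (x *m M) x.
  rewrite Mx_quad addrC lerD2l mulr_sumr; apply: ler_sum => p pe.
  by apply: ler_wpM2r; [exact: sqr_ge0|have /andP[] := w_edges pe].
apply: le_trans E; rewrite dotvE.
have -> : \sum_i x 0 i * x 0 i = \sum_i x 0 i ^+ 2 by apply: eq_bigr => i _;
  rewrite expr2.
move: P; set q := \sum_i x 0 i ^+ 2; set s := \sum_i x 0 i => P.
have k2 : kappa <= 2 by rewrite ge_min lexx.
have kw : kappa <= w0 * gamma ^+ 2 / 2 by rewrite ge_min lexx orbT.
have sn : 0 <= D * (s ^+ 2 / n%:R) by rewrite mulr_ge0 ?divr_ge0 ?sqr_ge0 ?(ltW
  n0) ?(ltW D0).
have E1 : kappa * (D * (s ^+ 2 / n%:R)) <= 2 * D / n%:R * s ^+ 2.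
  have -> : 2 * D / n%:R * s ^+ 2 = 2 * (D * (s ^+ 2 / n%:R)) by ring.
  exact: ler_wpM2r.
have E2 : kappa * (D * (q - s ^+ 2 / n%:R)) <= w0 * energy e (x 0).
  (* This difference is nonnegative by Cauchy-Schwarz, but if it were negative the claim would be
     trivial, so no proof of the sign is required. *)
  case: (lerP 0 (q - s ^+ 2 / n%:R)) => h; last first.
    apply: (@le_trans _ _ 0); last by rewrite mulr_ge0// ltW.
    rewrite pmulr_rle0 ?kappa_gt0// pmulr_rle0//; exact: ltW.
  apply: (@le_trans _ _ (w0 * gamma ^+ 2 / 2 * (D * (q - s ^+ 2 / n%:R)))).
    by apply: ler_wpM2r => //; rewrite mulr_ge0// ltW.
  have := ler_wpM2l (ltW w00) P; apply: le_trans; rewrite le_eqVlt; apply/orP; left.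
  by apply/eqP; ring.
have -> : kappa * D * q = kappa * (D * (q - s ^+ 2 / n%:R)) +
  kappa * (D * (s ^+ 2 / n%:R)) by ring.
exact: lerD.
Qed.

Let kD0 : 0 < kappa * D. Proof. by rewrite mulr_gt0// kappa_gt0. Qed.

Lemma Mx_unit : M \in unitmx.
Proof. exact: coercive_unit kD0 Mx_coercive. Qed.

Lemma Amx_unit : Amx e r \in unitmx.
Proof. by have := Mx_unit; rewrite unitmxZ// unitfE. Qed.

Local Notation cov := (gcov (Amx e r)).

Lemma cov_ge0 v : 0 <= cov v v.
Proof. exact: (inv_ge0 kD0 Mx_coercive). Qed.

Definition edgev (p : 'I_n * 'I_n) : 'rV[R]_n := delta_mx 0 p.1 - delta_mx 0 p.2.

Lemma dotv_delta i x : dotv (delta_mx 0 i) x = x 0 i.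
Proof.
rewrite dotvE (bigD1 i)//= mxE !eqxx mul1r big1 ?addr0// => j ji.
by rewrite mxE (negbTE ji) andbF mul0r.
Qed.

Lemma dotv_edgev p x : dotv (edgev p) x = x 0 p.1 - x 0 p.2.
Proof. by rewrite dotvDl dotvNl !dotv_delta. Qed.

Lemma edgev_norm p : p \in edges e -> dotv (edgev p) (edgev p) = 2.
Proof.
rewrite inE dotv_edgev !mxE !eqxx/= => /andP[p12 _].
have E : (p.1 == p.2) = false by apply/eqP => E; rewrite E ltnn in p12.
by rewrite E (eq_sym p.2) E /=; ring.
Qed.

Lemma cov_edge_le p q : p \in edges e -> q \in edges e ->
  `|cov (edgev p) (edgev q)| <= 2 / kappa / D.
Proof.
move=> pe qe; have := inv_le kD0 Mx_coercive (edgev p) (edgev q).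
rewrite !edgev_norm// => /le_trans; apply; rewrite le_eqVlt; apply/orP; left;
  apply/eqP.
by field; rewrite !gt_eqF// kappa_gt0.
Qed.

(** A Bessel inequality: [cov u (edgev q)] is the increment of [u *m S] along [q], so the sum is the
    energy of [u *m S], and the quadratic form of [M] at [u *m S] is [cov u u]. *)
Lemma sum_cov_sqr u : w0 * \sum_(q in edges e) cov u (edgev q) ^+ 2 <= cov u u.
Proof.
have := energy_le_quad (u *m S); rewrite (inv_quad kD0 Mx_coercive) => E.
rewrite (le_trans _ E)// ler_wpM2l ?(ltW w00)//.
by apply: ler_sum => q _; rewrite /gcov dotvC dotv_edgev.
Qed.

(** Duality with [sum_cov_sqr]: the double sum is [cov y y] for the combination [y] of edge vectors,
    and also the pairing of [a] with the covariances of [y] with the edges. AM-GM on this pairing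
    gives back half of it. *)
Lemma quad_cov_le (a : 'I_n * 'I_n -> R) :
  w0 * \sum_(p in edges e) \sum_(q in edges e) a p * a q * cov (edgev p) (edgev q)
  <= \sum_(p in edges e) a p ^+ 2.
Proof.
pose y := \sum_(p in edges e) a p *: edgev p.
have covy v : cov y v = \sum_(p in edges e) a p * cov (edgev p) v.
  rewrite /y; elim/big_rec2: _ => [|p m x _ IH].
    by rewrite /gcov mul0mx dotvE big1// => i _; rewrite mxE mul0r.
  by rewrite gcovDl gcovZl IH.
have yy : cov y y = \sum_(q in edges e) a q * cov y (edgev q).
  rewrite covy; apply: eq_bigr => p _; congr (_ * _).
  by rewrite gcovC//; exact: Amx_sym.
have -> : \sum_(p in edges e) \sum_(q in edges e) a p * a q * cov (edgev p)
  (edgev q)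
    = cov y y.
  rewrite yy exchange_big/=; apply: eq_bigr => q _; rewrite covy mulr_sumr.
  by apply: eq_bigr => p _; ring.
have S2 := sum_cov_sqr y.
have : 2 * (w0 * cov y y) <= \sum_(p in edges e) a p ^+ 2 +
    w0 * (w0 * \sum_(q in edges e) cov y (edgev q) ^+ 2).
  rewrite [in leLHS]yy !mulr_sumr -big_split/=; apply: ler_sum => p _.
  have := sqr_ge0 (a p - w0 * cov y (edgev p)); nra.
have := ler_wpM2l (ltW w00) S2; lra.
Qed.

(** Row [i] of [B = diag wdeg - M], that is, the weighted adjacency matrix minus [2 * D / n] in
    every entry. *)
Definition brow i : 'rV[R]_n := wdeg i *: delta_mx 0 i - delta_mx 0 i *m M.

Lemma brow_entry i k : brow i 0 k = (if e i k then wt i k else 0) - 2 * D / n%:R.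
Proof.
rewrite !mxE eqxx/= [X in _ - X](_ : _ = M i k); last first.
  rewrite (bigD1 i)//= mxE !eqxx mul1r big1 ?addr0// => j ji.
  by rewrite mxE (negbTE ji) andbF mul0r.
rewrite Mx_entry (eq_sym i); case: (eqVneq k i) => [->|_].
  by have [_ ei] := se; rewrite ei /=; ring.
by case: ifP => _ /=; ring.
Qed.

Lemma wt_rng i k : 0 <= (if e i k then wt i k else 0) <= 1.
Proof.
case: ifP => [/w_bounds/andP[a ->]|_]; last by rewrite lexx ler01.
by rewrite andbT (le_trans _ a)// ltW.
Qed.

Let Dn1 : 0 <= D / n%:R <= 1.
Proof. by rewrite divr_ge0 ?(ltW n0) ?(ltW D0)//= ler_pdivrMr// mul1r. Qed.

Lemma brow_le i k : `|brow i 0 k| <= 2.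
Proof.
rewrite brow_entry -mulrA; have := wt_rng i k; have := Dn1.
by move=> /andP[a b] /andP[c d]; rewrite ler_norml; apply/andP; split; lra.
Qed.

(** Each entry is a difference of nonnegative numbers, so its square is at most the sum of their
    squares. The adjacency part contributes at most [D], the constant part [4 * D ^+ 2 / n]. *)
Lemma brow_norm i : dotv (brow i) (brow i) <= 5 * D.
Proof.
apply: (@le_trans _ _ (\sum_k ((if e i k then 1 else 0) + 4 * (D / n%:R) ^+ 2))).
  rewrite dotvE; apply: ler_sum => k _; rewrite brow_entry -mulrA.
  have := Dn1; set t := D / _ => /andP[t0 t1].
  case: ifP => [/w_bounds/andP[a b]|_]; last by nra.
  have : 0 <= wt i k by rewrite (le_trans _ a)// ltW.
  nra.
rewrite big_split/= -big_mkcond/= sumr_const.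
have -> : #|e i| = deg e i by apply: eq_card => k.
rewrite sumr_const card_ord -[X in _ + X]mulr_natl.
have dD : (deg e i)%:R <= D by rewrite ler_nat deg_le_maxdeg.
have -> : n%:R * (4 * (D / n%:R) ^+ 2) = 4 * (D * (D / n%:R)).
  by field; rewrite gt_eqF.
have := Dn1; set t := D / _ => /andP[t0 t1]; have := D0; nra.
Qed.

Lemma wdeg_lower i : w0 * (deg e i)%:R <= wdeg i.
Proof.
have -> : (deg e i)%:R = \sum_(l | e i l) 1 :> R.
  by rewrite sumr_const; congr _%:R; apply: eq_card => k.
by rewrite mulr_sumr; apply: ler_sum => l /w_bounds/andP[]; rewrite mulr1.
Qed.

Lemma wdeg_ge i : w0 * gamma * D <= wdeg i.
Proof.
apply: le_trans (wdeg_lower i); rewrite -mulrA ler_wpM2l ?(ltW w00)//.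
exact: (deg_lower se hU).
Qed.

Lemma wdeg_gt0 i : 0 < wdeg i.
Proof. by apply: lt_le_trans (wdeg_ge i); rewrite !mulr_gt0. Qed.

(* With [M = diag wdeg - B], expanding [S = diag^-1 + diag^-1 B S] twice leaves
   the remainder [diag^-1 B S B diag^-1], whose entries are small because the
   rows of [B] have norm [O(D^(1/2))] and [S] has norm [O(D^-1)]. *)
Lemma cov_delta i k :
  `|cov (delta_mx 0 i) (delta_mx 0 k) - (i == k)%:R / wdeg i|
  <= (2 + 5 / kappa) / (w0 * gamma) ^+ 2 / D ^+ 2.
Proof.
pose y := brow i *m S.
have yE : y = wdeg i *: (delta_mx 0 i *m S) - delta_mx 0 i.
  by rewrite /y mulmxBl -scalemxAl mulmxK ?Mx_unit.
(* The second expansion: coordinate [k] of [y *m M = brow i], with the diagonal part of [M]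
   separated from [B]. *)
have yk : y 0 k * wdeg k = brow i 0 k + dotv y (brow k).
  have : (y *m M) 0 k = brow i 0 k by rewrite /y mulmxKV ?Mx_unit.
  rewrite -[(y *m M) 0 k]dotv_delta dotvC dotvM Mx_sym => <-.
  by rewrite -dotvDr /brow addrC subrK dotvZr (dotvC y) dotv_delta mulrC.
(* Here 2 bounds the entry of [brow i], and [5 / kappa] is [(5 * D + 5 * D) / (2 * kappa * D)] from
   [inv_le]. *)
have ykb : `|y 0 k| <= (2 + 5 / kappa) / (w0 * gamma * D).
  rewrite ler_pdivlMr ?mulr_gt0//.
  apply: (@le_trans _ _ `|y 0 k * wdeg k|).
    by rewrite normrM (gtr0_norm (wdeg_gt0 k)) ler_wpM2l// wdeg_ge.
  rewrite yk (le_trans (ler_normD _ _))// lerD ?brow_le//.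
  apply: (le_trans (inv_le kD0 Mx_coercive _ _)).
  rewrite ler_pdivrMr ?mulr_gt0 ?kappa_gt0//.
  apply: (le_trans (lerD (brow_norm i) (brow_norm k))).
  by rewrite le_eqVlt; apply/orP; left; apply/eqP; field; rewrite gt_eqF ?kappa_gt0.
have -> : cov (delta_mx 0 i) (delta_mx 0 k) - (i == k)%:R / wdeg i = y 0 k / wdeg i.
  rewrite /gcov dotvC dotv_delta yE !mxE eqxx/= eq_sym.
  by field; rewrite gt_eqF ?wdeg_gt0.
rewrite normrM normfV (gtr0_norm (wdeg_gt0 i)).
rewrite ler_pdivrMr ?wdeg_gt0//; apply: (le_trans ykb).
apply: (@le_trans _ _ ((2 + 5 / kappa) / (w0 * gamma) ^+ 2 /
  D ^+ 2 * (w0 * gamma * D))).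
  by rewrite le_eqVlt; apply/orP; left; apply/eqP; field;
    rewrite !gt_eqF// kappa_gt0.
apply: ler_wpM2l; last exact: wdeg_ge.
rewrite !divr_ge0 ?sqr_ge0 ?exprn_ge0 ?(ltW D0)//.
by rewrite addr_ge0// divr_ge0// ltW// kappa_gt0.
Qed.

End Laplacian.

(** * Edge weights in terms of the ratio bound *)

Section EdgeWeights.
Context {R : realType}.
Variables (a b rho K : R).
Hypotheses (a0 : 0 < a) (b0 : 0 < b) (rho0 : 0 <= rho) (rhoK : rho <= K).
Hypotheses (ab : a / b <= 1 + rho) (ba : b / a <= 1 + rho).

Let s0 : 0 < a + b. Proof. exact: addr_gt0. Qed.
Let ab' : a <= (1 + rho) * b. Proof. by rewrite -ler_pdivrMr. Qed.
Let ba' : b <= (1 + rho) * a. Proof. by rewrite -ler_pdivrMr. Qed.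

Lemma lam_diff_le : `|a / (a + b) - b / (b + a)| <= rho.
Proof.
rewrite (addrC b) -mulrBl normrM normfV (gtr0_norm s0) ler_pdivrMr//.
have := rho0; have := a0; have := b0; have := ab'; have := ba' => *.
by rewrite ler_norml; apply/andP; split; nra.
Qed.

(** The two fractions have sum 1, so four times their product is 1 minus the square of their
    difference. *)
Lemma lam_mul_eq : 4 * (a / (a + b) * (b / (b + a))) =
  1 - (a / (a + b) - b / (b + a)) ^+ 2.
Proof. by field; rewrite (addrC b) gt_eqF. Qed.

Lemma lam_mul_le1 : 4 * (a / (a + b) * (b / (b + a))) <= 1.
Proof. by rewrite lam_mul_eq gerBl sqr_ge0. Qed.

Lemma lam_mul_ge : 1 - rho ^+ 2 <= 4 * (a / (a + b) * (b / (b + a))).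
Proof.
rewrite lam_mul_eq lerD2l lerN2 -(real_normK (num_real (_ - _))).
by rewrite ler_sqr ?nnegrE// lam_diff_le.
Qed.

(** [lam_mul_ge] says nothing once [rho >= 1]; this bound stays positive and depends on [K] only,
    because [a + b] is at most [2 + K] times either term. *)
Lemma lam_mul_lower : 4 / (2 + K) ^+ 2 <= 4 * (a / (a + b) * (b / (b + a))).
Proof.
have K0 : 0 < 2 + K by have := rho0; have := rhoK; lra.
rewrite (addrC b) mulf_div ler_pM2l// -expr2 ler_pdivlMr ?exprn_gt0//.
rewrite mulrC ler_pdivrMr ?exprn_gt0//.
have h1 : a + b <= (2 + K) * b.
  have : rho * b <= K * b by rewrite ler_wpM2r// ltW.
  have := ab'; lra.
have h2 : a + b <= (2 + K) * a.
  have : rho * a <= K * a by rewrite ler_wpM2r// ltW.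
  have := ba'; lra.
have := ler_pM (ltW s0) (ltW s0) h1 h2.
rewrite -expr2 => /le_trans; apply; rewrite le_eqVlt; apply/orP; left;
  apply/eqP; ring.
Qed.

End EdgeWeights.

(** * Estimates of the sums over edges *)

Section Bounds.
Context {R : realType} {n : nat}.
Variables (e : rel 'I_n) (r : 'I_n -> R) (w0 gamma rho : R).
Hypotheses (se : simple_graph e) (n1 : (1 < n)%N).
Hypotheses (w00 : 0 < w0) (gamma0 : 0 < gamma) (rho0 : 0 <= rho).
Local Notation D := ((maxdeg e)%:R : R).
Local Notation N := (n%:R : R).
Hypothesis D0 : 0 < D.
Hypothesis Dn : D <= n%:R.
Hypothesis hU : forall U : {set 'I_n}, (1 <= #|U|)%N -> (#|U|.*2 <= n)%N ->
  gamma * D * #|U|%:R <= #|boundary e U|%:R.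
Hypothesis w_bounds : forall j k, e j k -> w0 <= wt r j k <= 1.
Hypothesis w_rho : forall j k, e j k -> 1 - rho ^+ 2 <= wt r j k.
Hypothesis l_rho : forall j k, e j k -> `|lam r j k - lam r k j| <= rho.

Local Notation E := (edges e).
Local Notation c p q := (gcov (Amx e r) (edgev p) (edgev q)).
Local Notation kappa := (kappa w0 gamma).
Local Notation w p := (wt r p.1 p.2).

Definition cov_const : R := 2 / kappa.

Let k0 : 0 < kappa. Proof. exact: kappa_gt0. Qed.
Let c10 : 0 < cov_const. Proof. exact: divr_gt0. Qed.
Let N0 : 0 < N. Proof. by rewrite ltr0n ltnW. Qed.

Lemma edge_cov_le p q : p \in E -> q \in E -> `|c p q| <= cov_const / D.
Proof. exact: (cov_edge_le se n1 w00 gamma0 D0 hU w_bounds). Qed.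

Lemma edge_cov_ge0 p : 0 <= c p p.
Proof. exact: (cov_ge0 se n1 w00 gamma0 D0 hU w_bounds). Qed.

Lemma edge_var_le p : p \in E -> c p p <= cov_const / D.
Proof. by move=> pE; have := edge_cov_le pE pE;
  rewrite ger0_norm ?edge_cov_ge0. Qed.

Lemma edge_rel p : p \in E -> e p.1 p.2.
Proof. by rewrite inE => /andP[]. Qed.

Lemma edge_ne p : p \in E -> (p.1 == p.2) = false.
Proof. by rewrite inE => /andP[p12 _]; apply/eqP => F; rewrite F ltnn in p12. Qed.

(** Handshake: the number of edges is half the sum of the degrees; the factor 1/2 is given away. *)
Lemma sum_edges_le (F : 'I_n * 'I_n -> R) (B : R) : 0 <= B ->
  (forall p, p \in E -> F p <= B) -> \sum_(p in E) F p <= N * D * B.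
Proof.
move=> B0 FB; apply: (@le_trans _ _ (\sum_(p in E) B)); first exact: ler_sum.
have := sum_edges_endpoints se (fun=> B / 2 : R).
rewrite (eq_bigr (fun=> B)) => [->|p _]; last by field.
apply: (@le_trans _ _ (\sum_(i < n) D * (B / 2))).
  apply: ler_sum => i _; rewrite ler_wpM2r ?divr_ge0// ler_nat;
    exact: deg_le_maxdeg.
rewrite sumr_const card_ord -[leLHS]mulr_natl -[leRHS]mulrA;
  do 2 (rewrite ler_wpM2l ?(ltW N0) ?(ltW D0)//).
lra.
Qed.

Lemma abs_sum_edges_le (F : 'I_n * 'I_n -> R) (B : R) : 0 <= B ->
  (forall p, p \in E -> `|F p| <= B) -> `|\sum_(p in E) F p| <= N * D * B.
Proof.
move=> B0 FB; apply: (le_trans (ler_norm_sum _ _ _)); exact: sum_edges_le.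
Qed.

(** For fixed [p] the inner sum is O(1 / D) by [sum_cov_sqr], although it runs over O(n D) edges. *)
Lemma sum_edge_cov_sqr : \sum_(p in E) \sum_(q in E) c p q ^+ 2 <=
  N * (cov_const / w0).
Proof.
apply: (@le_trans _ _ (N * D * (cov_const / D / w0))); last first.
  by rewrite le_eqVlt; apply/orP; left; apply/eqP; field; rewrite !gt_eqF.
apply: sum_edges_le; first by rewrite !divr_ge0 ?ltW.
move=> p pE; rewrite ler_pdivlMr// mulrC.
apply: le_trans (edge_var_le pE).
exact: (sum_cov_sqr se n1 w00 gamma0 D0 hU w_bounds).
Qed.

Definition coef3 p : R := - (4 / 3) *
  (lam r p.1 p.2 * lam r p.2 p.1 * (lam r p.1 p.2 - lam r p.2 p.1)).
Definition coef4 p : R := 2 / 3 *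
  (lam r p.1 p.2 * lam r p.2 p.1 * (1 - 6 * (lam r p.1 p.2 * lam r p.2 p.1))).
Definition coef6 p : R := - (4 / 45) * (lam r p.1 p.2 * lam r p.2 p.1
    * (1 - 30 * (lam r p.1 p.2 * lam r p.2 p.1)
         + 120 * (lam r p.1 p.2 ^+ 2 * lam r p.2 p.1 ^+ 2))).

Lemma wt_edge01 p : p \in E -> 0 <= w p <= 1.
Proof.
move=> /edge_rel /w_bounds /andP[a ->]; rewrite andbT (le_trans _ a)//; exact: ltW.
Qed.

Lemma coef3_le p : p \in E -> `|coef3 p| <= rho.
Proof.
move=> pE; have /andP[] := wt_edge01 pE; have := l_rho (edge_rel pE);
  rewrite /coef3 /wt.
set l := lam r p.1 p.2 * _; set d := _ - _;
  rewrite !ler_norml => /andP[d1 d2] h1 h2.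
apply/andP; split; nra.
Qed.

Lemma coef4_le p : p \in E -> `|coef4 p| <= 1.
Proof.
move=> pE; have /andP[] := wt_edge01 pE; rewrite /coef4 /wt.
set l := lam r p.1 p.2 * _; rewrite ler_norml => h1 h2; apply/andP; split; nra.
Qed.

Lemma coef6_le p : p \in E -> `|coef6 p| <= 1.
Proof.
move=> pE; have /andP[] := wt_edge01 pE; rewrite /coef6 /wt -exprMn.
set l := lam r p.1 p.2 * _ => h1 h2.
have l0 : 0 <= l by lra.
have l1 : l <= 1 / 4 by lra.
(* On [[0, 1/4]] the polynomial lies between [1 - 30/4] and [1 + 120/16]. *)
have b1 : -7 <= 1 - 30 * l + 120 * l ^+ 2 by have := sqr_ge0 l; lra.
have b2 : 1 - 30 * l + 120 * l ^+ 2 <= 9.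
  have : l ^+ 2 <= 1 / 16 by have := ler_pM l0 l0 l1 l1; rewrite -expr2; lra.
  lra.
rewrite ler_norml; apply/andP; split; nra.
Qed.

Lemma mean_f6_le : `|\sum_(p in E) coef6 p * (15 * c p p ^+ 3)| <=
  15 * cov_const ^+ 3 * (N / D ^+ 2).
Proof.
apply: (@le_trans _ _ (N * D * (15 * (cov_const / D) ^+ 3))); last first.
  by rewrite le_eqVlt; apply/orP; left; apply/eqP; field; rewrite !gt_eqF.
apply: abs_sum_edges_le; first by rewrite mulr_ge0// exprn_ge0// divr_ge0 ?ltW.
move=> p pE; rewrite normrM -[leRHS]mul1r ler_pM ?coef6_le//.
rewrite ger0_norm ?mulr_ge0 ?exprn_ge0 ?edge_cov_ge0// ler_wpM2l// lerXn2r
  ?nnegrE ?edge_cov_ge0 ?edge_var_le//.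
by rewrite divr_ge0 ?ltW.
Qed.

Lemma mean_f4_le : `|\sum_(p in E) coef4 p * (3 * c p p ^+ 2)| <=
  3 * cov_const ^+ 2 * (N / D).
Proof.
apply: (@le_trans _ _ (N * D * (3 * (cov_const / D) ^+ 2))); last first.
  by rewrite le_eqVlt; apply/orP; left; apply/eqP; field; rewrite !gt_eqF.
apply: abs_sum_edges_le; first by rewrite mulr_ge0// exprn_ge0// divr_ge0 ?ltW.
move=> p pE; rewrite normrM -[leRHS]mul1r ler_pM ?coef4_le//.
rewrite ger0_norm ?mulr_ge0 ?exprn_ge0 ?edge_cov_ge0// ler_wpM2l// lerXn2r
  ?nnegrE ?edge_cov_ge0 ?edge_var_le//.
by rewrite divr_ge0 ?ltW.
Qed.

(** One factor [c p q ^+ 2] is kept for [sum_edge_cov_sqr], the other two covariances are bounded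
    pointwise; [96 = 72 + 24]. *)
Lemma variance_f4_le : \sum_(p in E) \sum_(q in E)
   coef4 p * coef4 q * (72 * c p p * c q q * c p q ^+ 2 + 24 * c p q ^+ 4) <=
  96 * cov_const ^+ 3 / w0 * (N / D ^+ 2).
Proof.
apply: (@le_trans _ _ (96 * (cov_const /
  D) ^+ 2 * \sum_(p in E) \sum_(q in E) c p q ^+ 2)).
  rewrite mulr_sumr; apply: ler_sum => p pE; rewrite mulr_sumr;
    apply: ler_sum => q qE.
  apply: (le_trans (ler_norm _)); rewrite normrM -[leRHS]mul1r ler_pM//.
    by rewrite normrM -[leRHS]mul1r ler_pM ?coef4_le.
  have cc : c p q ^+ 2 <= (cov_const / D) ^+ 2.
    by rewrite -(real_normK (num_real (c p q))) lerXn2r ?nnegrE ?edge_cov_le//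
      divr_ge0 ?ltW.
  have -> : 72 * c p p * c q q * c p q ^+ 2 + 24 * c p q ^+ 4 =
    (72 * (c p p * c q q) + 24 * c p q ^+ 2) * c p q ^+ 2 by ring.
  have pq : c p p * c q q <= (cov_const / D) ^+ 2
    by rewrite expr2 ler_pM ?edge_cov_ge0 ?edge_var_le.
  have pq0 : 0 <= c p p * c q q by rewrite mulr_ge0 ?edge_cov_ge0.
  rewrite ger0_norm; last by rewrite mulr_ge0 ?sqr_ge0// addr_ge0// mulr_ge0
    ?sqr_ge0.
  rewrite ler_wpM2r ?sqr_ge0//; lra.
apply: (le_trans (ler_wpM2l _ sum_edge_cov_sqr));
  first by rewrite mulr_ge0 ?sqr_ge0.
by rewrite le_eqVlt; apply/orP; left; apply/eqP; field; rewrite !gt_eqF.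
Qed.

(** The part linear in [c p q] is a quadratic form in the vector of the [coef3 p * c p p], hence a
    case of [quad_cov_le]. The cubic part is treated like the variance of f4; [15 = 9 + 6]. *)
Lemma second_moment_f3_le : \sum_(p in E) \sum_(q in E)
   coef3 p * coef3 q * (9 * c p p * c q q * c p q + 6 * c p q ^+ 3) <=
  15 * cov_const ^+ 2 / w0 * (rho ^+ 2 * N / D).
Proof.
have -> : \sum_(p in E) \sum_(q in E)
   coef3 p * coef3 q * (9 * c p p * c q q * c p q + 6 * c p q ^+ 3) =
   9 * (\sum_(p in E) \sum_(q in E) (coef3 p * c p p) * (coef3 q * c q q) * c p q)
   + \sum_(p in E) \sum_(q in E) coef3 p * coef3 q * (6 * c p q ^+ 3).
  rewrite mulr_sumr -big_split/=; apply: eq_bigr => p _.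
  by rewrite mulr_sumr -big_split/=; apply: eq_bigr => q _; ring.
have B1 : \sum_(p in E) \sum_(q in E) (coef3 p * c p p) * (coef3 q * c q q) * c p q
    <= (N * D * (rho * (cov_const / D)) ^+ 2) / w0.
  rewrite ler_pdivlMr// mulrC.
  apply: (le_trans (quad_cov_le se n1 w00 gamma0 D0 hU w_bounds (fun p =>
    coef3 p * c p p))).
  apply: sum_edges_le; first exact: sqr_ge0.
  move=> p pE; rewrite -(real_normK (num_real _)) lerXn2r ?nnegrE//.
    by rewrite mulr_ge0// divr_ge0 ?ltW.
  by rewrite normrM ler_pM ?coef3_le ?edge_cov_le.
have B2 : \sum_(p in E) \sum_(q in E) coef3 p * coef3 q * (6 * c p q ^+ 3) <=
    6 * rho ^+ 2 * (cov_const / D) * (N * (cov_const / w0)).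
  apply: (@le_trans _ _ (6 * rho ^+ 2 * (cov_const /
    D) * \sum_(p in E) \sum_(q in E) c p q ^+ 2)).
    rewrite mulr_sumr; apply: ler_sum => p pE; rewrite mulr_sumr;
      apply: ler_sum => q qE.
    have -> : coef3 p * coef3 q * (6 * c p q ^+ 3) =
      (coef3 p * coef3 q) * (6 * c p q) * c p q ^+ 2 by ring.
    rewrite ler_wpM2r ?sqr_ge0//; apply: (le_trans (ler_norm _)).
    have -> : 6 * rho ^+ 2 * (cov_const / D) =
      (rho * rho) * (6 * (cov_const / D)) by ring.
    rewrite normrM ler_pM//.
      by rewrite normrM ler_pM ?coef3_le.
    by rewrite normrM ger0_norm// ler_wpM2l// edge_cov_le.
  apply: (ler_wpM2l _ sum_edge_cov_sqr).
  apply: mulr_ge0; [by rewrite mulr_ge0 ?sqr_ge0|by rewrite divr_ge0 ?ltW].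
have -> : 15 * cov_const ^+ 2 / w0 * (rho ^+ 2 * N / D) =
  9 * (N * D * (rho * (cov_const / D)) ^+ 2 / w0) +
    6 * rho ^+ 2 * (cov_const / D) * (N * (cov_const / w0)).
  by field; rewrite !gt_eqF.
by rewrite lerD// ler_wpM2l.
Qed.

Definition remainder_const : R := (2 + 5 / kappa) / (w0 * gamma) ^+ 2.
Local Notation t p := ((deg e p.1)%:R^-1 + (deg e p.2)%:R^-1 : R).

Lemma deg_ge i : gamma * D <= (deg e i)%:R.
Proof. exact: (deg_lower se hU). Qed.

Lemma deg_inv_bounds i :
  0 <= (deg e i)%:R^-1 :> R /\ (deg e i)%:R^-1 <= (gamma * D)^-1.
Proof.
have g0 : 0 < gamma * D by rewrite mulr_gt0.
split; first by rewrite invr_ge0.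
by rewrite lef_pV2 ?posrE ?deg_ge// (lt_le_trans g0 (deg_ge i)).
Qed.

(** The weights lie between [1 - rho ^+ 2] and 1, so [wdeg] is below the degree by at most the
    fraction [rho ^+ 2] of it. *)
Lemma wdeg_inv i :
  `|(wdeg e r i)^-1 - (deg e i)%:R^-1| <= rho ^+ 2 / (w0 * gamma * D).
Proof.
have d0 : 0 < (deg e i)%:R :> R by apply: lt_le_trans (deg_ge i); rewrite mulr_gt0.
have W0 : 0 < wdeg e r i by exact: (wdeg_gt0 se n1 w00 gamma0 D0 hU w_bounds).
have dE : (deg e i)%:R = \sum_(l | e i l) 1 :> R.
  by rewrite sumr_const; congr _%:R; apply: eq_card => k.
have up : wdeg e r i <= (deg e i)%:R.
  by rewrite dE; apply: ler_sum => l /w_bounds/andP[].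
have lo : (deg e i)%:R * (1 - rho ^+ 2) <= wdeg e r i.
  by rewrite dE mulr_suml; apply: ler_sum => l /w_rho; rewrite mul1r.
rewrite ger0_norm; last by rewrite subr_ge0 lef_pV2 ?posrE.
have -> : (wdeg e r i)^-1 - (deg e i)%:R^-1 =
    ((deg e i)%:R - wdeg e r i) / (deg e i)%:R / wdeg e r i.
  by field; rewrite !gt_eqF.
apply: ler_pM.
- by rewrite divr_ge0 ?subr_ge0// ltW.
- by rewrite invr_ge0 ltW.
- rewrite ler_pdivrMr//; lra.
- rewrite lef_pV2 ?posrE ?mulr_gt0//.
  exact: (wdeg_ge se n1 w00 hU w_bounds).
Qed.

(** Expanding [edgev p] gives four entries of [S], hence the factor 4; only the two diagonal ones
    have a main term, and the off-diagonal ones are pure remainder. *)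
Lemma variance_approx p : p \in E ->
  `|c p p - t p| <= 4 * remainder_const / D ^+ 2
    + 2 * (rho ^+ 2 / (w0 * gamma * D)).
Proof.
move=> pE; pose g i k := gcov (Amx e r) (delta_mx 0 i : 'rV[R]_n) (delta_mx 0 k).
have gE i k : `|g i k - (i == k)%:R / wdeg e r i| <= remainder_const / D ^+ 2.
  exact: (cov_delta se n1 w00 gamma0 D0 Dn hU w_bounds).
have cE : c p p = g p.1 p.1 + g p.2 p.2 - 2 * g p.1 p.2.
  have As : (Amx e r)^T = Amx e r by exact: Amx_sym.
  have -> : edgev p = delta_mx 0 p.1 + (-1) *: delta_mx 0 p.2 :> 'rV[R]_n
    by rewrite scaleN1r.
  rewrite !(gcovDl, gcovDr As, gcovZl, gcovZr As) (gcovC As (delta_mx 0 p.2)).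
  by rewrite /g; ring.
have := gE p.1 p.1; have := gE p.2 p.2; have := gE p.1 p.2.
rewrite !eqxx edge_ne// mul0r subr0 !mul1r.
have := wdeg_inv p.1; have := wdeg_inv p.2.
rewrite cE -[4 * remainder_const / _]mulrA !ler_norml =>
  /andP[? ?] /andP[? ?] /andP[? ?] /andP[? ?] /andP[? ?].
by apply/andP; split; lra.
Qed.

(** On each edge [coef4 p * 3 + 1 / 4] equals [(1 - w) * (3 * w + 1) / 4], which is O(rho^2). What
    then remains is a quarter of a difference of squares, factored so that [variance_approx]
    applies. *)
Lemma mean_f4_approx :
  `|\sum_(p in E) coef4 p * (3 * c p p ^+ 2)
    - - (1 / 4) * \sum_(p in E) t p ^+ 2|
  <= (cov_const ^+ 2 + (cov_const + 2 / gamma) / (w0 * gamma))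
       * (rho ^+ 2 * N / D)
     + remainder_const * (cov_const + 2 / gamma) * (N / D ^+ 2).
Proof.
have c20 : 0 <= remainder_const by rewrite divr_ge0 ?sqr_ge0// addr_ge0//
  divr_ge0// ltW.
pose B := rho ^+ 2 * (cov_const / D) ^+ 2 + 1 / 4 *
  ((4 * remainder_const / D ^+ 2 + 2 * (rho ^+ 2 /
    (w0 * gamma * D))) * (cov_const / D + 2 / (gamma * D))).
have g0 : 0 < gamma * D by rewrite mulr_gt0.
have wg0 : 0 < w0 * gamma by rewrite mulr_gt0.
have B1 : 0 <= 4 * remainder_const / D ^+ 2 + 2 * (rho ^+ 2 / (w0 * gamma * D)).
  apply: addr_ge0; first by rewrite divr_ge0 ?sqr_ge0// mulr_ge0.
  by rewrite mulr_ge0// divr_ge0 ?sqr_ge0// ltW// mulr_gt0.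
have B2 : 0 <= cov_const / D + 2 / (gamma * D) by rewrite addr_ge0// divr_ge0 ?ltW.
have B0 : 0 <= B.
  apply: addr_ge0; first by rewrite mulr_ge0 ?sqr_ge0.
  by apply: mulr_ge0; [rewrite divr_ge0|exact: mulr_ge0].
have -> : \sum_(p in E) coef4 p * (3 * c p p ^+ 2) - - (1 /
  4) * \sum_(p in E) t p ^+ 2 =
    \sum_(p in E) (coef4 p * (3 * c p p ^+ 2) + 1 / 4 * t p ^+ 2).
  by rewrite mulNr opprK mulr_sumr -big_split.
apply: (@le_trans _ _ (N * D * B)); last first.
  rewrite /B.
  have -> : N * D * (rho ^+ 2 * (cov_const / D) ^+ 2 + 1 / 4 *
    ((4 * remainder_const / D ^+ 2 +
      2 * (rho ^+ 2 / (w0 * gamma * D))) * (cov_const / D + 2 / (gamma * D))))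
    = (cov_const ^+ 2 + 1 / 2 * ((cov_const +
      2 / gamma) / (w0 * gamma))) * (rho ^+ 2 * N / D)
     + remainder_const * (cov_const + 2 / gamma) * (N / D ^+ 2).
    by field; rewrite !gt_eqF.
  rewrite lerD2r ler_wpM2r//.
    by rewrite divr_ge0 ?(ltW D0)// mulr_ge0 ?sqr_ge0// ltW.
  rewrite lerD2l.
  have : 0 <= (cov_const + 2 / gamma) / (w0 * gamma).
    by rewrite divr_ge0 ?ltW// addr_gt0// divr_gt0.
  lra.
apply: abs_sum_edges_le => // p pE.
have -> : coef4 p * (3 * c p p ^+ 2) + 1 / 4 * t p ^+ 2 =
  (coef4 p * 3 + 1 / 4) * c p p ^+ 2 + 1 / 4 * ((t p - c p p) * (c p p +
    t p)) by ring.
apply: (le_trans (ler_normD _ _)); apply: lerD.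
  rewrite normrM ler_pM//.
    have /andP[v1 v2] := wt_edge01 pE; have := w_rho (edge_rel pE).
    have -> : coef4 p * 3 + 1 / 4 = (1 - w p) * ((3 * w p + 1) / 4).
      by rewrite /coef4 /wt; field.
    move=> v3; rewrite ger0_norm; last by rewrite mulr_ge0//; lra.
    nra.
  rewrite ger0_norm ?sqr_ge0// lerXn2r ?nnegrE ?edge_cov_ge0 ?edge_var_le//.
  by rewrite divr_ge0 ?ltW.
have [t1 t1'] := deg_inv_bounds p.1; have [t2 t2'] := deg_inv_bounds p.2.
rewrite normrM ger0_norm ?divr_ge0// ler_wpM2l ?divr_ge0// normrM ler_pM//.
  by rewrite distrC variance_approx.
rewrite ger0_norm; last by rewrite addr_ge0 ?edge_cov_ge0// addr_ge0.
by rewrite lerD ?edge_var_le//; lra.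
Qed.

End Bounds.

Section EdgeForms.
Context {R : realType} {n : nat} (e : rel 'I_n) (r : 'I_n -> R).
Implicit Type x : 'rV[R]_n.

Lemma f3E x : f3 e r x = \sum_(p in edges e) coef3 r p * dotv (edgev p) x ^+ 3.
Proof. by rewrite /f3 mulr_sumr; apply: eq_bigr => p _;
  rewrite dotv_edgev /coef3; ring. Qed.

Lemma f4E x : f4 e r x = \sum_(p in edges e) coef4 r p * dotv (edgev p) x ^+ 4.
Proof. by rewrite /f4 mulr_sumr; apply: eq_bigr => p _;
  rewrite dotv_edgev /coef4; ring. Qed.

Lemma f6E x : f6 e r x = \sum_(p in edges e) coef6 r p * dotv (edgev p) x ^+ 6.
Proof. by rewrite /f6 mulr_sumr; apply: eq_bigr => p _;
  rewrite dotv_edgev /coef6; ring. Qed.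

End EdgeForms.

(** * Uniform constants and comparison with the logarithmic factor *)

Theorem lemma2 (R : realType) (eps gamma K : R) :
  0 < eps -> 0 < gamma ->
  exists C : R,
  forall (G : forall n : nat, rel 'I_n) (b : forall n : nat, 'I_n -> int)
         (r : forall n : nat, 'I_n -> R) (Rn : nat -> R),
  let Delta n : R := (maxdeg (G n))%:R in
  let logterm n : R := ln (2 * n%:R / Delta n) in
  (forall n, simple_graph (G n)) ->
  (forall n, exists o : rel 'I_n,
      orientation (G n) o /\ forall j, b n j = imbalance o j) ->
  (\forall n \near \oo,
      n%:R `^ (1 / 3 + eps) <= Delta n /\ Delta n <= n%:R - 1) ->
  (\forall n \near \oo, gamma * Delta n <= cheeger R (G n)) ->
  (\forall n \near \oo,
    [/\ forall j, 0 < r n j,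
        forall j, \sum_(k | G n j k) (r n j - r n k) / (r n j + r n k)
                  = (b n j)%:~R,
        forall j k, G n j k -> r n j / r n k <= 1 + Rn n
      & 0 <= Rn n <= K]) ->
  (fun n => Rn n ^+ 2 * (n%:R / Delta n) * logterm n)
    =o_\oo (fun n => ln n%:R) ->
  \forall n \near \oo,
  forall (d : measure_display) (T : measurableType d) (P : probability T R)
         (X : {RV P >-> n.-tuple (measurableTypeR R)}),
  has_density X (gauss_density (Amx (G n) (r n))) ->
  let F3 w := f3 (G n) (r n) (row_of_tuple (X w)) in
  let F4 w := f4 (G n) (r n) (row_of_tuple (X w)) in
  let F6 w := f6 (G n) (r n) (row_of_tuple (X w)) in
  let S := \sum_(p in edges (G n))
             ((deg (G n) p.1)%:R^-1 + (deg (G n) p.2)%:R^-1) ^+ 2 : R in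
  [/\ (`| 'E_P[F4] - (- (1 / 4) * S)%:E |
       <= (C * (Rn n ^+ 2 * (Delta n)^-1 * n%:R
                + (Delta n) ^- 2 * n%:R * logterm n))%:E)%E,
      (`| 'E_P[F4] | <= (C * ((Delta n)^-1 * n%:R))%:E)%E,
      (`| 'V_P[F3] |
       <= (C * (Rn n ^+ 2 * (Delta n)^-1 * n%:R * logterm n))%:E)%E,
      (`| 'E_P[F6] | <= (C * ((Delta n) ^- 2 * n%:R * logterm n))%:E)%E
    & (`| 'V_P[F4] | <= (C * ((Delta n) ^- 2 * n%:R * logterm n))%:E)%E].
Proof.
move=> eps0 gamma0.
pose w0 : R := 4 / (2 + K) ^+ 2.
(* For negative [K] the bounds on [Rn n] contradict each other; excluding this case makes [2 + K]
   positive, as the choice of [w0] needs. *)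
have [K0|K0] := ltP K 0.
  exists 0 => G b r Rn Delta logterm _ _ _ _ Hr _.
  near=> n; exfalso.
  have [_ _ _ /andP[r0 rK]] : [/\ forall j, 0 < r n j,
        forall j, \sum_(k | G n j k) (r n j - r n k) / (r n j + r n k)
                  = (b n j)%:~R,
        forall j k, G n j k -> r n j / r n k <= 1 + Rn n
      & 0 <= Rn n <= K] by near: n; exact: Hr.
  by have := le_lt_trans (le_trans r0 rK) K0; rewrite ltxx.
have w00 : 0 < w0 by rewrite divr_gt0// exprn_gt0// ltr_wpDr.
pose k1 := cov_const w0 gamma; pose k2 := remainder_const w0 gamma.
have kap0 : 0 < kappa w0 gamma := kappa_gt0 w00 gamma0.
have k10 : 0 < k1 by rewrite /k1 /cov_const divr_gt0.
have k20 : 0 <= k2.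
  by rewrite divr_ge0 ?sqr_ge0// addr_ge0// divr_ge0// ltW.
pose C1 := k1 ^+ 2 + (k1 + 2 / gamma) / (w0 * gamma).
pose C2 := k2 * (k1 + 2 / gamma).
pose C3 := 3 * k1 ^+ 2.
pose C4 := 15 * k1 ^+ 2 / w0.
pose C5 := 15 * k1 ^+ 3.
pose C6 := 96 * k1 ^+ 3 / w0.
have kg : 0 <= k1 + 2 / gamma by rewrite addr_ge0 ?divr_ge0 ?ltW.
have C10 : 0 <= C1 by rewrite addr_ge0 ?sqr_ge0// divr_ge0// ltW// mulr_gt0.
have C20 : 0 <= C2 by rewrite mulr_ge0.
have C30 : 0 <= C3 by rewrite mulr_ge0// sqr_ge0.
have C40 : 0 <= C4 by rewrite divr_ge0 ?(ltW w00)// mulr_ge0// sqr_ge0.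
have C50 : 0 <= C5 by rewrite mulr_ge0// exprn_ge0// ltW.
have C60 : 0 <= C6 by rewrite divr_ge0 ?(ltW w00)// mulr_ge0// exprn_ge0// ltW.
have l2 : 0 < ln 2 :> R by rewrite ln_gt0// ltr1n.
pose C0 := C1 + C2 + C3 + C4 + C5 + C6.
have C00 : 0 <= C0 by rewrite /C0; lra.
have li0 : 0 <= (ln 2)^-1 :> R by rewrite invr_ge0 ltW.
(* [C0] dominates each of the constants, which depend on [gamma] and [K] only. The term 1 serves
   bounds without a logarithm, and [(ln 2)^-1] those where one has to be inserted. *)
exists (C0 * (1 + (ln 2)^-1)) => G b r Rn Delta logterm Gs _ HD Hh Hr _.
near=> n => d T P X Xp.
have n1 : (1 < n)%N by near: n; exists 2.
have [D1 D2] : n%:R `^ (1 / 3 + eps) <= Delta n /\ Delta n <= n%:R - 1.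
  by near: n; exact: HD.
have hn : gamma * Delta n <= cheeger R (G n) by near: n; exact: Hh.
have [r0 _ rR /andP[R0 RK]] : [/\ forall j, 0 < r n j,
        forall j, \sum_(k | G n j k) (r n j - r n k) / (r n j + r n k)
                  = (b n j)%:~R,
        forall j k, G n j k -> r n j / r n k <= 1 + Rn n
      & 0 <= Rn n <= K] by near: n; exact: Hr.
have n0 : 0 < n%:R :> R by rewrite ltr0n ltnW.
have D0 : 0 < Delta n by apply: lt_le_trans D1; rewrite powR_gt0.
have Dn : Delta n <= n%:R by apply: le_trans D2 _; rewrite gerBl.
have hU U := cheeger_boundary (U := U) hn.
have [es _] := Gs n.
have rC j k : G n j k -> r n k / r n j <= 1 + Rn n by move=> jk; apply: rR;
  rewrite es.
have wb j k : G n j k -> w0 <= wt (r n) j k <= 1.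
  move=> jk; apply/andP; split.
    exact: (lam_mul_lower (r0 j) (r0 k) R0 RK (rR _ _ jk) (rC _ _ jk)).
  exact: (lam_mul_le1 (r0 j) (r0 k)).
have wr j k : G n j k -> 1 - Rn n ^+ 2 <= wt (r n) j k.
  by move=> jk; exact: (lam_mul_ge (r0 j) (r0 k) R0 (rR _ _ jk) (rC _ _ jk)).
have lr j k : G n j k -> `|lam (r n) j k - lam (r n) k j| <= Rn n.
  by move=> jk; exact: (lam_diff_le (r0 j) (r0 k) R0 (rR _ _ jk) (rC _ _ jk)).
(* From [Delta n <= n] the argument of the logarithm is at least 2. *)
have lt1 : 1 <= (ln 2)^-1 * logterm n.
  rewrite mulrC ler_pdivlMr// mul1r /logterm ler_ln ?posrE ?divr_gt0 ?mulr_gt0//.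
  by rewrite ler_pdivlMr// ler_pM2l.
have As : (Amx (G n) (r n))^T = Amx (G n) (r n) := Amx_sym (r n) (Gs n).
have Au : Amx (G n) (r n) \in unitmx := Amx_unit (Gs n) n1 w00 gamma0 D0 hU wb.
have cp v := cov_ge0 (Gs n) n1 w00 gamma0 D0 hU wb v.
pose F3 (w : T) := f3 (G n) (r n) (row_of_tuple (X w)).
pose F4 (w : T) := f4 (G n) (r n) (row_of_tuple (X w)).
pose F6 (w : T) := f6 (G n) (r n) (row_of_tuple (X w)).
rewrite -/F3 -/F4 -/F6.
have F3E : F3 = fun w => \sum_(p in edges (G n)) coef3 (r n) p * dotv (edgev p)
  (row_of_tuple (X w)) ^+ 3.
  by apply/funext => w; exact: f3E.
have F4E : F4 = fun w => \sum_(p in edges (G n)) coef4 (r n) p * dotv (edgev p)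
  (row_of_tuple (X w)) ^+ 4.
  by apply/funext => w; exact: f4E.
have F6E : F6 = fun w => \sum_(p in edges (G n)) coef6 (r n) p * dotv (edgev p)
  (row_of_tuple (X w)) ^+ 6.
  by apply/funext => w; exact: f6E.
(* The values written [_] here and below are supplied by unification with the moment lemmas. *)
have EF4 : ('E_P[F4] = _)%E := etrans (congr1 _ F4E)
  (expectation_has_mean (mean_sum4 As Au Xp cp (edges (G n)) (coef4 (r n))
    (@edgev R n))).
have EF6 : ('E_P[F6] = _)%E := etrans (congr1 _ F6E)
  (expectation_has_mean (mean_sum6 As Au Xp cp (edges (G n)) (coef6 (r n))
    (@edgev R n))).
have VF4 : ('V_P[F4] = _)%E := etrans (congr1 _ F4E)
  (variance_sum4 As Au Xp cp (edges (G n)) (coef4 (r n)) (@edgev R n)).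
have mF3 : measurable_fun setT F3.
  rewrite F3E; under eq_fun do rewrite big_mkcond/=.
  apply: measurable_sum => p; case: (p \in _) => //.
  by apply: measurable_funM => //; exact/measurable_funX/measurable_linear_form.
have VF3 : (`|'V_P[F3]| <= _)%E := variance_le_sqr mF3
  (has_mean_ext (fun w => congr1 (fun f => f w ^+ 2) (esym F3E)) erefl
    (mean_sqr_sum3 As Au Xp cp (edges (G n)) (coef3 (r n)) (@edgev R n))).
have B1 := mean_f4_approx (Gs n) n1 w00 gamma0 D0 Dn hU wb wr.
have B2 := mean_f4_le (Gs n) n1 w00 gamma0 D0 hU wb.
have B3 := second_moment_f3_le (Gs n) n1 w00 gamma0 R0 D0 hU wb lr.
have B4 := mean_f6_le (Gs n) n1 w00 gamma0 D0 hU wb.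
have B5 := variance_f4_le (Gs n) n1 w00 gamma0 D0 hU wb.
pose x := n%:R / Delta n ^+ 2; pose y := Rn n ^+ 2 * n%:R / Delta n;
  pose z := n%:R / Delta n.
have x0 : 0 <= x by rewrite divr_ge0 ?sqr_ge0// ltW.
have y0 : 0 <= y by rewrite divr_ge0 ?mulr_ge0 ?sqr_ge0// ltW.
have z0 : 0 <= z by rewrite divr_ge0// ltW.
(* [scale] enlarges a bound by the logarithm, [scale1] is for the terms that carry none. *)
have scale (c u : R) : 0 <= c <= C0 -> 0 <= u ->
    c * u <= C0 * (1 + (ln 2)^-1) * (u * logterm n).
  move=> /andP[c0 cC] u0.
  apply: (@le_trans _ _ (C0 * u)); first by rewrite ler_wpM2r.
  rewrite -mulrA ler_wpM2l// mulrCA -[leLHS]mulr1 ler_wpM2l//.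
  have l0 : 0 <= logterm n by rewrite -(pmulr_rge0 _ (divr_gt0 ltr01 l2)) div1r
    (le_trans _ lt1).
  by rewrite mulrDl mul1r (le_trans lt1)// lerDr.
have scale1 (c u : R) : 0 <= c <= C0 -> 0 <= u -> c * u <= C0 * (1 + (ln 2)^-1) * u.
  move=> /andP[c0 cC] u0; rewrite ler_wpM2r// (le_trans cC)// ler_peMr// lerDl.
  exact: li0.
have C1le : 0 <= C1 <= C0 by rewrite C10 /C0; lra.
have C2le : 0 <= C2 <= C0 by rewrite C20 /C0; lra.
have C3le : 0 <= C3 <= C0 by rewrite C30 /C0; lra.
have C4le : 0 <= C4 <= C0 by rewrite C40 /C0; lra.
have C5le : 0 <= C5 <= C0 by rewrite C50 /C0; lra.
have C6le : 0 <= C6 <= C0 by rewrite C60 /C0; lra.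
have xE : Delta n ^- 2 * n%:R * logterm n = x * logterm n
  by rewrite [_ * n%:R]mulrC.
have yE : Rn n ^+ 2 * (Delta n)^-1 * n%:R = y by rewrite /y; ring.
have zE : (Delta n)^-1 * n%:R = z by rewrite mulrC.
rewrite xE yE zE; split.
- rewrite EF4 -EFinB abse_EFin lee_fin; apply: (le_trans B1).
  by rewrite [leRHS]mulrDr lerD// ?scale ?scale1.
- by rewrite EF4 abse_EFin lee_fin; apply: (le_trans B2); exact: scale1.
- by apply: (le_trans VF3); rewrite lee_fin; apply: (le_trans B3); exact: scale.
- by rewrite EF6 abse_EFin lee_fin; apply: (le_trans B4); exact: scale.
- rewrite gee0_abs ?variance_ge0// VF4 lee_fin; apply: (le_trans B5); exact: scale.
Unshelve. all: by end_near. Qed.
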